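(* There is an absolute constant $C>0$ and an adaptive (possibly randomized) arm-pulling algorithm which, given inputs $n\ge 2$, $1\le K\le n/2$, $\epsilon\in(0,1/2]$ and $\delta\in(0,1/2]$, has the following guarantee for every instance with $n$ arms whose reward distributions are supported on $[0,1]$: with probability at least $1-\delta$, the algorithm outputs an $\epsilon$-top-$K$ set of arms and makes at most $$C\left(\log\frac1\epsilon+\log\frac1\delta\right)H^{(t,\epsilon)}$$ pulls in total, where $t=t(\epsilon,K)$ and $H^{(t,\epsilon)}=\sum_{i=1}^n\min\{\Delta_i^{-2},(\Psi_t^{\epsilon})^{-2}\}$.
   Context: Stochastic $n$-armed bandit model: arm $i\in[n]$ has an unknown reward distribution $\mathcal D_i$ supported on $[0,1]$ with mean $\theta_i$; arms are indexed so that $\theta_1\ge\dots\ge\theta_n$ (unknown to the algorithm). An algorithm sequentially and adaptively chooses arms to pull; each pull of arm $i$ yields an independent sample from $\mathcal D_i$; it finally outputs a set of arms. For $T\subseteq[n]$, $|T|=K$, the aggregate regret is $\mathcal R_T=\frac1K(\sum_{i=1}^K\theta_i-\sum_{i\in T}\theta_i)$; $T$ is an $\epsilon$-top-$K$ set if $|T|=K$ and $\mathcal R_T\le\epsilon$. Gaps: $\Delta_i=\theta_i-\theta_{K+1}$ for $i\le K$, $\Delta_i=\theta_K-\theta_i$ for $i\ge K+1$ (with $\Delta_i^{-2}=+\infty$ if $\Delta_i=0$). $t(\epsilon,K)$ is the largest $t\in\{0,1,\dots,K-1\}$ with $\Delta_{K-t}\cdot t\le K\epsilon$ and $\Delta_{K+t+1}\cdot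 t\le K\epsilon$. $\Psi_t=\min(\Delta_{K-t},\Delta_{K+t+1})$ and $\Psi_t^{\epsilon}=\max(\epsilon,\Psi_t)$. *)

(* Defs.v *)
From HB Require Import structures.
From mathcomp Require Import all_boot all_order all_algebra.
From mathcomp Require Import all_classical all_reals all_analysis.
Set Implicit Arguments. Unset Strict Implicit. Unset Printing Implicit Defensive.
Import Order.TTheory GRing.Theory Num.Theory.
Local Open Scope classical_set_scope.
Local Open Scope ring_scope.

Section Quantities.
Variables (R : realType) (n K : nat) (theta : 'I_n -> R) (eps : R).

(* means sorted in nonincreasing order; sorted_mean j = theta_j (1-based),
   i.e. the j-th largest mean *)
Definition sorted_means : seq R := sort (fun x y => y <= x) [seq theta i | i <- enum 'I_n].
Definition sorted_mean (j : nat) : R := nth 0 sorted_means j.-1.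

Definition gap (j : nat) : R :=
  if (j <= K)%N then sorted_mean j - sorted_mean K.+1
  else sorted_mean K - sorted_mean j.

Definition t_cond (t : nat) : bool :=
  (gap (K - t) * t%:R <= K%:R * eps) && (gap (K + t + 1) * t%:R <= K%:R * eps).
Definition t_eps : nat := \max_(t < K | t_cond t) t.

Definition Psi (t : nat) : R := Num.min (gap (K - t)) (gap (K + t + 1)).
Definition Psi_eps (t : nat) : R := Num.max eps (Psi t).

(* min{Delta^-2, Psi^-2} with the convention Delta^-2 = +oo when Delta = 0 *)
Definition min_inv_sq (Delta Ps : R) : R :=
  if Delta == 0 then Ps ^- 2 else Num.min (Delta ^- 2) (Ps ^- 2).

Definition H_complexity : R :=
  \sum_(1 <= j < n.+1) min_inv_sq (gap j) (Psi_eps t_eps).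

Definition agg_regret (T : {set 'I_n}) : R :=
  (\sum_(1 <= j < K.+1) sorted_mean j - \sum_(i in T) theta i) / K%:R.
Definition eps_topK (T : {set 'I_n}) : Prop :=
  #|T| = K /\ agg_regret T <= eps.
End Quantities.

(* A policy sees its internal random seed u and the history so far     *)
(* (list of (arm pulled, reward observed)), and either pulls an arm    *)
(* (inl i) or stops and outputs a set of arms (inr T).                 *)
Definition policy (R : realType) (n : nat) :=
  R -> seq ('I_n * R) -> 'I_n + {set 'I_n}.

Section Run.
Variables (R : realType) (n : nat) (alg : policy R n).
(* reward table: the k-th pull (0-based) of arm i returns X i k *)
Variables (u : R) (X : 'I_n -> nat -> R).

Definition npulls (h : seq ('I_n * R)) (i : 'I_n) : nat :=
  count (fun p => p.1 == i) h.

Fixpoint history (s : nat) : seq ('I_n * R) :=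
  match s with
  | 0 => [::]
  | s'.+1 =>
      let h := history s' in
      match alg u h with
      | inl i => rcons h (i, X i (npulls h i))
      | inr _ => h
      end
  end.

Definition stops_at (tau : nat) (T : {set 'I_n}) : Prop :=
  (forall s, (s < tau)%N -> exists i, alg u (history s) = inl i) /\
  alg u (history tau) = inr T.
End Run.

Definition mutually_independent d (Omega : measurableType d) (R : realType)
  (P : probability Omega R) (I : eqType) (Y : I -> Omega -> R) : Prop :=
  forall (J : seq I) (B : I -> set R), uniq J ->
    (forall j, j \in J -> measurable (B j)) ->
    P (\bigcap_(j in [set j | j \in J]) (Y j @^-1` B j)) =
    (\prod_(j <- J) P (Y j @^-1` B j))%E.

Definition joint_family d (Omega : measurableType d) (R : realType) (n : nat)
  (U : Omega -> R) (X : 'I_n -> nat -> Omega -> R) : option ('I_n * nat) -> Omega -> R :=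
  fun o => match o with None => U | Some (i, k) => X i k end.

(* Main.v *)
Require Import Defs.
From HB Require Import structures.
From mathcomp Require Import all_boot all_order all_algebra.
From mathcomp Require Import all_classical all_reals all_analysis.
From mathcomp Require Import measurable_realfun ring lra zify.
Set Implicit Arguments. Unset Strict Implicit. Unset Printing Implicit Defensive.
Import Order.TTheory GRing.Theory Num.Theory.
Local Open Scope ring_scope.

(* The reward estimates of an arm are its empirical means after deterministic
   numbers of pulls, so no independence between phases is ever used: by a Chernoff
   bound every single estimate is accurate except with probability
   [(eps * delta) ^ 21], and Markov's inequality bounds the number of unreliable
   arms. Everything else is a deterministic statement about tables of rewards.

   If [n] is at most polynomial (in [1 / eps]) times [K], the unreliable arms are a
   tiny fraction of [K]. Phase [r] estimates every undecided arm up to [2 ^ -r / 16],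
   accepts (rejects) an arm beating (beaten by) all arms on the other side of the
   current cut by [2 ^ -r / 2], and stops once [min k (|S| - k) * 2 ^ -r] is at most
   [K * eps / 2], [k] being the number of arms still to be chosen among the
   undecided set [S]. If the cut has drifted because of unreliable arms, then either
   the gaps [Delta_i] are still the relevant ones, or the arms on one side are all
   decided and the procedure stops. It also stops as soon as [2 ^ -r] is below a
   quarter of [Psi_t], since then at most [t] arms on either side are undecided.

   If [n] is much larger than [K], unreliable arms may outnumber [K]. Then each phase
   runs a halving tournament on the best [eps ^ 3 * n] arms, whose estimates are so
   few that they can be afforded at accuracy [eps] whatever the gaps; it yields a set
   of [K] nearly best arms and a threshold close to the [K]-th mean, and arms well
   below the threshold are rejected. *)

(** * Adaptive programs and their policies *)

(** The bound contains no [log n], so a union bound over the arms is out of reach: some arms are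
    always misjudged, and every decision rule has to tolerate a bounded number of them without
    letting the errors cascade. On the cost side, all gaps, [Psi_t] and [eps] are at most 1, so [H]
    is at least [n]: whatever costs a constant times [n] times the logarithmic factor is free. This
    explains the powers of [eps]. There are at most [4 / eps] phases, and each may add as many wrong
    decisions as there are unreliable arms, so for small [n] their number must be of order
    [eps ^ 2 * K]; then sampling all of them at [eps ^- 2] pulls each costs only [O(K)]. For large
    [n], a tournament on [eps ^ 3 * n] arms at [eps ^- 2] pulls each costs [eps * n], which summed
    over the phases is [O(n)]; hence the split at [4 * K <= eps ^ 3 * n]. *)

Section Programs.
Variables (R : realType) (n : nat).

(* [Ask N k]: make sure that every arm [i] has been pulled at least [N i] times,
   then let [k] see exactly the first [N i] rewards of each arm. *)
Inductive prog : Type :=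
| Ret of {set 'I_n}
| Ask of ('I_n -> nat) & (('I_n -> nat -> R) -> prog).

(** Masking the unseen part of the table with 0 is what lets a policy, which knows only a finite
    history [h], evaluate a continuation: once the demand is met,
    [visible N (table h) = visible N X]. *)
Definition visible (N : 'I_n -> nat) (X : 'I_n -> nat -> R) : 'I_n -> nat -> R :=
  fun i k => if (k < N i)%N then X i k else 0.

Fixpoint run (p : prog) (X : 'I_n -> nat -> R) : {set 'I_n} :=
  match p with Ret T => T | Ask N k => run (k (visible N X)) X end.

(** A maximum and not a sum: successive requests read the same prefix of an arm's rewards, so
    earlier pulls are reused. *)
Fixpoint demand (p : prog) (X : 'I_n -> nat -> R) (i : 'I_n) : nat :=
  match p with Ret _ => 0%N | Ask N k => maxn (N i) (demand (k (visible N X)) X i) end.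

Definition rewards (h : seq ('I_n * R)) (i : 'I_n) : seq R :=
  [seq p.2 | p <- h & p.1 == i].

Definition table (h : seq ('I_n * R)) : 'I_n -> nat -> R :=
  fun i k => nth 0 (rewards h i) k.

Fixpoint policy_of (p : prog) (h : seq ('I_n * R)) : 'I_n + {set 'I_n} :=
  match p with
  | Ret T => inr T
  | Ask N k =>
      if [pick i | (npulls h i < N i)%N] is Some i then inl i
      else policy_of (k (visible N (table h))) h
  end.

Definition consistent (X : 'I_n -> nat -> R) (h : seq ('I_n * R)) : Prop :=
  forall i k, (k < npulls h i)%N -> table h i k = X i k.

Lemma size_rewards h i : size (rewards h i) = npulls h i.
Proof. by rewrite size_map size_filter. Qed.

Lemma npulls_rcons (h : seq ('I_n * R)) (j : 'I_n) x i : npulls (rcons h (j, x)) i = (npulls h i + (j == i))%N.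
Proof. by rewrite /npulls -cats1 count_cat /= addn0. Qed.

Lemma consistent_rcons X h j :
  consistent X h -> consistent X (rcons h (j, X j (npulls h j))).
Proof.
move=> hX i k; rewrite npulls_rcons /table /rewards filter_rcons /=.
case: eqP => [->|_]; last by rewrite addn0; apply: hX.
rewrite map_rcons nth_rcons size_rewards addn1 ltnS leq_eqVlt.
case/orP => [/eqP ->|kh]; first by rewrite ltnn eqxx.
by rewrite kh; apply: hX.
Qed.

Lemma step_pull p X h i :
  consistent X h -> policy_of p h = inl i -> (npulls h i < demand p X i)%N.
Proof.
move=> hX; elim: p => [//|N k IH] /=.
case: pickP => [j Hj [<-]|H]; first exact: leq_trans Hj (leq_maxl _ _).
have -> : visible N (table h) = visible N X.
  apply/funext => j; apply/funext => l; rewrite /visible.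
  by case: ifP => // lN; apply: hX; apply: leq_trans lN _; rewrite leqNgt H.
by move=> /IH lt; apply: leq_trans lt (leq_maxr _ _).
Qed.

Lemma step_return p X h T : consistent X h -> policy_of p h = inr T -> T = run p X.
Proof.
move=> hX; elim: p => [U [<-]//|N k IH] /=.
case: pickP => // H.
have -> : visible N (table h) = visible N X.
  apply/funext => j; apply/funext => l; rewrite /visible.
  by case: ifP => // lN; apply: hX; apply: leq_trans lN _; rewrite leqNgt H.
exact: IH.
Qed.

Lemma consistent_history (alg : policy R n) u X s : consistent X (history alg u X s).
Proof.
elim: s => [//|s IH] /=; case: (alg u _) => // i; exact: consistent_rcons.
Qed.

Lemma sum_npulls (h : seq ('I_n * R)) : (\sum_i npulls h i = size h)%N.
Proof.
elim/last_ind: h => [|h [j x] IH]; first by rewrite big1.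
under eq_bigr do rewrite npulls_rcons.
rewrite big_split IH /= size_rcons -[RHS]addn1; congr addn.
rewrite (bigD1 j) //= eqxx big1 // => i; rewrite eq_sym => /negbTE ->//.
Qed.

(** Each step either stops or adds a pull of an arm that is still below its demand. Running for one
    step more than the total demand without stopping would give a history longer than that total. *)
Lemma prog_stops p (u : R) X :
  exists tau, stops_at (fun=> policy_of p) u X tau (run p X) /\
    (tau <= \sum_i demand p X i)%N.
Proof.
pose alg : policy R n := fun=> policy_of p.
pose h := history alg u X.
have hX s : consistent X (h s) by exact: consistent_history.
have hrq s i : (npulls (h s) i <= demand p X i)%N.
  elim: s => [//|s IH]; rewrite /h /= -/(h s) /alg.
  case E: (policy_of p (h s)) => [j|//].
  rewrite npulls_rcons; case: eqP => [<-|_]; rewrite ?addn0 ?addn1//.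
  exact: step_pull (hX s) E.
pose stopped s := if policy_of p (h s) is inr _ then true else false.
have [/existsP[s0 Hs0]|/existsPn H] := boolP [exists s : 'I_(\sum_i demand p X i).+1, stopped s].
  have ex : exists s, stopped s by exists s0.
  case: (ex_minnP ex) => tau Htau min.
  exists tau; split; last by apply: leq_trans (min _ Hs0) _; rewrite -ltnS.
  split.
    move=> s lts; case E: (policy_of p (h s)) => [i|T]; first by exists i.
    by have := min s; rewrite /stopped E => /(_ isT); rewrite leqNgt lts.
  move: Htau; rewrite /stopped -/alg -/h; case E: (policy_of p (h tau)) => [//|T] _.
  by rewrite (step_return (hX tau) E).
exfalso.
have sz s : (s <= (\sum_i demand p X i).+1)%N -> size (h s) = s.
  elim: s => [//|s IH] lts; have := IH (ltnW lts).
  rewrite /h /= -/(h s) /alg; have := H (Ordinal lts); rewrite /stopped /=.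
  by case: (policy_of p (h s)) => [i|//] _; rewrite size_rcons => ->.
have := sz _ (leqnn _); rewrite -sum_npulls => E.
have : (\sum_i npulls (h (\sum_i demand p X i).+1) i <= \sum_i demand p X i)%N.
  by apply: leq_sum => i _; apply: hrq.
by rewrite E ltnn.
Qed.

End Programs.

(** * Concentration of empirical means *)

Section Staircase.
Variable R : realType.

(** For [a >= 0] this is the minimum of [N] and the integer part of [a], written as a sum of
    indicators so that the mean can be exchanged with it. *)
Definition stair (N : nat) (a : R) : R := \sum_(k < N) (k.+1%:R <= a)%R%:R.

Lemma stair_le N (a : R) : 0 <= a -> stair N a <= a.
Proof.
move=> a0; rewrite /stair; elim: N => [|N IH]; first by rewrite big_ord0.
rewrite big_ord_recr /=; case: (leP N.+1%:R a) => [Na|_] /=; last by rewrite addr0.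
apply: le_trans Na; rewrite -[N.+1%:R]natr1 lerD2r.
rewrite -[X in _ <= X%:R]card_ord -sum1_card natr_sum ler_sum// => i _.
by rewrite ler_nat; case: (i.+1%:R <= a).
Qed.

Lemma le_stair N (a : R) : 0 <= a <= N%:R -> a <= stair N a + 1.
Proof.
rewrite /stair; elim: N => [|N IH] /andP[a0 aN].
  by rewrite big_ord0 add0r (le_trans aN).
have [aN'|Na] := leP a N%:R.
  apply: (le_trans (IH _)); first by rewrite a0.
  by rewrite lerD2r big_ord_recr /= lerDl.
rewrite big_ord_recr /= (eq_bigr (fun=> 1)); last first.
  move=> i _; rewrite (le_trans _ (ltW Na))//.
  by rewrite ler_nat.
rewrite sumr_const card_ord (le_trans aN)// -natr1 lerD2r lerDl//.
Qed.

End Staircase.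

Section Expectation.
Local Open Scope classical_set_scope.
Context d (Omega : measurableType d) (R : realType) (P : probability Omega R).
Local Open Scope ereal_scope.

Local Notation EE f := (\int[P]_w (f w)%:E).

Lemma mean_le (f g : Omega -> R) : measurable_fun setT f -> measurable_fun setT g ->
  (forall w, 0 <= f w)%R -> (forall w, f w <= g w)%R -> EE f <= EE g.
Proof.
move=> mf mg f0 fg; apply: ge0_le_integral => //.
- by move=> x _; rewrite lee_fin.
- exact/measurable_EFinP.
- exact/measurable_EFinP.
- by move=> x _; rewrite lee_fin.
Qed.

Lemma meanZ (k : R) (f : Omega -> R) : measurable_fun setT f ->
  (forall w, 0 <= f w)%R -> (0 <= k)%R -> EE (fun w => k * f w)%R = k%:E * EE f.
Proof.
move=> mf f0 k0; under eq_integral do rewrite EFinM.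
rewrite ge0_integralZl//; first exact/measurable_EFinP.
by move=> x _; rewrite lee_fin.
Qed.

Lemma mean_cst (a : R) : \int[P]_(w in setT) a%:E = a%:E.
Proof. by rewrite integral_cst// [X in _ * X](@probability_setT _ _ _ P) mule1. Qed.

Lemma mean_sum (I : Type) (s : seq I) (f : I -> Omega -> R) :
  (forall i, measurable_fun setT (f i)) -> (forall i w, 0 <= f i w)%R ->
  EE (fun w => \sum_(i <- s) f i w)%R = \sum_(i <- s) EE (f i).
Proof.
move=> mf f0; under eq_integral do rewrite -sumEFin.
rewrite ge0_integral_sum// => i; first exact/measurable_EFinP.
by move=> x _; rewrite lee_fin.
Qed.

Lemma meanD (f g : Omega -> R) :
  measurable_fun setT f -> measurable_fun setT g ->
  (forall w, 0 <= f w)%R -> (forall w, 0 <= g w)%R ->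
  EE (fun w => f w + g w)%R = EE f + EE g.
Proof.
move=> mf mg f0 g0; under eq_integral do rewrite EFinD.
rewrite ge0_integralD//; by [move=> x _; rewrite lee_fin | apply/measurable_EFinP].
Qed.

(* A comparison on indicators of events about [Z] extends to bounded
   nonnegative functions of [Z], through a uniform staircase approximation. *)
Lemma mean_comparison (Y Z Z0 : Omega -> R) (f : R -> R) (q M : R) :
  measurable_fun setT Y -> measurable_fun setT Z -> measurable_fun setT Z0 ->
  measurable_fun setT f -> (forall w, 0 <= Y w)%R -> (0 <= q)%R ->
  (forall x, 0 <= f x)%R -> (forall w, f (Z w) <= M)%R -> (0 < M)%R ->
  (forall B, measurable B ->
     EE (fun w => Y w * \1_(Z @^-1` B) w)%R <= q%:E * P (Z0 @^-1` B)) ->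
  EE (fun w => Y w * f (Z w))%R <= q%:E * EE (f \o Z0).
Proof.
move=> mY mZ mZ0 mf Y0 q0 f0 fM M0 H.
have mfZ : measurable_fun setT (f \o Z) by apply: measurableT_comp.
have mfZ0 : measurable_fun setT (f \o Z0) by apply: measurableT_comp.
apply/lee_addgt0Pr => e e0.
(* Rounding [f] down to a multiple of [h = M / N] loses at most [h] times the mean of [Y], that is
   at most [h * q]; [N] is chosen to make this at most [e]. *)
pose N := (Num.bound (M * q / e)).
have N0 : (0 < N%:R :> R)%R.
  by apply: le_lt_trans (archi_boundP _); rewrite divr_ge0// ?mulr_ge0// ltW.
pose h := (M / N%:R)%R.
have h0 : (0 < h)%R by rewrite divr_gt0.
have hqe : (h * q <= e)%R.
  rewrite /h mulrAC ler_pdivrMr// -ler_pdivrMl// mulrC ltW//.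
  by apply: archi_boundP; rewrite divr_ge0// ?mulr_ge0// ltW.
pose B k := [set x | (k.+1%:R * h <= f x)%R].
have mB k : measurable (B k).
  have -> : B k = setT `&` f @^-1` `[(k.+1%:R * h)%R, +oo[.
    by rewrite setTI; apply/seteqP; split => x /=; rewrite in_itv /= andbT.
  exact: mf.
have mZB k : measurable (Z @^-1` B k) by rewrite -[X in measurable X]setTI; exact: mZ.
have mZ0B k : measurable (Z0 @^-1` B k) by rewrite -[X in measurable X]setTI; exact: mZ0.
have stE (V : Omega -> R) w :
    (h * stair N (f (V w) / h) = \sum_(k < N) h * \1_(V @^-1` B k) w)%R.
  rewrite /stair mulr_sumr; apply: eq_bigr => k _; congr (_ * _)%R.
  rewrite indicE ler_pdivlMr// /B; congr ((nat_of_bool _)%:R)%R.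
  by apply/idP/idP => [?|]; rewrite ?inE.
pose U k (w : Omega) : R := (h * (Y w * \1_(Z @^-1` B k) w))%R.
have mU k : measurable_fun setT (U k).
  by apply: measurable_funM => //; apply: measurable_funM => //; exact: measurable_indic.
have U0 k w : (0 <= U k w)%R.
  by rewrite /U !mulr_ge0// ?ltW// indicE.
apply: (@le_trans _ _ (EE (fun w => (\sum_(k <- enum 'I_N) U k w + h * Y w)%R))).
  apply: mean_le.
  - exact: measurable_funM.
  - by apply: measurable_funD; [exact: measurable_sum|exact: measurable_funM].
  - by move=> w; rewrite mulr_ge0.
  - move=> w; rewrite /U -mulr_sumr big_enum /= -mulr_sumr mulrCA mulr_sumr -stE.
    rewrite [(h * Y w)%R]mulrC -mulrDr ler_wpM2l// -[X in (_ <= _ + X)%R]mulr1 -mulrDr.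
    rewrite -ler_pdivrMl// mulrC; apply: le_stair.
    rewrite divr_ge0 ?(ltW h0)//= ler_pdivrMr// /h mulrCA divff ?mulr1//.
    by rewrite lt0r_neq0.
rewrite meanD//; first last.
- by move=> w; rewrite mulr_ge0// ltW.
- by move=> w; rewrite sumr_ge0.
- exact: measurable_funM.
- exact: measurable_sum.
have EY : EE Y <= q%:E.
  have := H setT measurableT; rewrite !preimage_setT probability_setT mule1.
  by under eq_integral do rewrite indicT mulr1.
apply: leeD; last first.
  rewrite meanZ ?(ltW h0)//.
  apply: le_trans (lee_wpmul2l _ EY) _; first by rewrite lee_fin ltW.
  by rewrite -EFinM lee_fin.
rewrite mean_sum//.
apply: (@le_trans _ _ (\sum_(k <- enum 'I_N) q%:E * EE (fun w => h * \1_(Z0 @^-1` B k) w)%R)).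
  apply: lee_sum => k _; rewrite /U !meanZ ?(ltW h0)//; first last.
  - by move=> w; rewrite mulr_ge0// indicE.
  - by apply: measurable_funM => //; exact: measurable_indic.
  rewrite integral_indic// setIT muleCA lee_pmul2l// ?lte_fin//.
  exact: H.
rewrite -ge0_sume_distrr; last first.
  move=> i _; apply: integral_ge0 => w _; rewrite lee_fin mulr_ge0// ?ltW//.
rewrite -mean_sum; first last.
- by move=> i w; rewrite mulr_ge0// ?ltW// indicE.
- by move=> i; apply: measurable_funM => //; exact: measurable_indic.
apply: lee_wpmul2l; first by rewrite lee_fin.
apply: mean_le.
- apply: measurable_sum => i; apply: measurable_funM => //; exact: measurable_indic.
- by [].
- by move=> w; rewrite sumr_ge0// => i _; rewrite mulr_ge0// ?ltW// indicE.
- move=> w; rewrite big_enum /= -stE -ler_pdivlMl// [X in (_ <= X)%R]mulrC.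
  by apply: stair_le; rewrite divr_ge0// ltW.
Qed.

End Expectation.

(** * Moment generating functions and a Chernoff bound *)

Section Chernoff.
Local Open Scope classical_set_scope.
Context d (Omega : measurableType d) (R : realType) (P : probability Omega R).

Local Notation EE f := (\int[P]_w (f w)%:E)%E.

(** Inverting [1 - y <= expR (- y)] gives [expR y <= (1 - y)^-1], and [(1 + y + 2 * y ^+ 2) * (1 -
    y) = 1 + y ^+ 2 * (1 - 2 * y)]. *)
Lemma expR_le_quad (y : R) : y <= 1 / 2 -> expR y <= 1 + y + 2 * y ^+ 2.
Proof.
move=> y2; have p : 0 < 1 - y by lra.
have h : 1 - y <= expR (- y) by have := expR_ge1Dx (- y); lra.
rewrite -[y in expR y]opprK expRN.
apply: (@le_trans _ _ (1 - y)^-1); first by rewrite lef_pV2// ?posrE ?expR_gt0.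
rewrite -[X in X <= _]mul1r ler_pdivrMr//.
have : 0 <= y ^+ 2 * (1 - 2 * y) by rewrite mulr_ge0 ?sqr_ge0//; lra.
nra.
Qed.

(** With [s] nonnegative only means of nonnegative functions occur. Negative [s] is reached in
    [mgf_bound] through the reflection [1 - Z], which has mean [1 - theta] and turns [s] into
    [- s]. *)
Lemma mgf_ge0 (Z : Omega -> R) (theta s : R) : measurable_fun setT Z ->
  (forall w, 0 <= Z w <= 1) -> EE Z = theta%:E -> 0 <= s <= 1 / 2 ->
  (EE (fun w => expR (s * (Z w - theta))) <= (expR (2 * s ^+ 2))%:E)%E.
Proof.
move=> mZ Z01 Zt /andP[s0 s12].
have t01 : 0 <= theta <= 1.
  rewrite -!lee_fin -Zt integral_ge0/=; last first.
    by move=> w _; rewrite lee_fin; case/andP: (Z01 w).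
  have <- : (EE (cst 1 : Omega -> R) = 1)%E.
    exact: mean_cst.
  by apply: mean_le => // w; case/andP: (Z01 w).
have mexp : measurable_fun setT (fun w => expR (s * (Z w - theta))).
  apply: measurableT_comp => //; apply: measurable_funM => //.
  exact: measurable_funB.
apply: (@le_trans _ _ (EE (fun w => (1 - s * theta + 2 * s ^+ 2) + s * Z w))).
  apply: mean_le => //.
  - by apply: measurable_funD => //; apply: measurable_funM.
  - move=> w; have /andP[Z0 Z1] := Z01 w; case/andP: t01 => t0 t1.
    apply: (le_trans (expR_le_quad _)); first by nra.
    have : (Z w - theta) ^+ 2 <= 1 by nra.
    have : 0 <= s ^+ 2 by apply: sqr_ge0.
    rewrite exprMn; nra.
have a0 : 0 <= 1 - s * theta + 2 * s ^+ 2.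
  by case/andP: t01 => t0 t1; have := sqr_ge0 s; nra.
rewrite meanD//; first last.
- by move=> w; rewrite mulr_ge0//; case/andP: (Z01 w).
- exact: measurable_funM.
rewrite meanZ// ?Zt; last by move=> w; case/andP: (Z01 w).
rewrite mean_cst -EFinM -EFinD lee_fin.
by apply: le_trans (expR_ge1Dx _); lra.
Qed.

Variables (X : nat -> Omega -> R).
Hypothesis mX : forall k, measurable_fun setT (X k).
Hypothesis X01 : forall k w, 0 <= X k w <= 1.
Hypothesis Xid : forall k B, measurable B -> P (X k @^-1` B) = P (X 0%N @^-1` B).
Hypothesis Xindep : forall (J : seq nat) (B : nat -> set R), uniq J ->
    (forall j, j \in J -> measurable (B j)) ->
    P (\bigcap_(j in [set j | j \in J]) (X j @^-1` B j)) =
    (\prod_(j <- J) P (X j @^-1` B j))%E.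

Let theta : R := fine ('E_P[X 0%N]).

Let mpre k B : measurable B -> measurable (X k @^-1` B).
Proof. by move=> mB; rewrite -[X in measurable X]setTI; exact: mX. Qed.

Lemma mean_reward : EE (X 0%N) = theta%:E.
Proof.
rewrite /theta expectation.unlock fineK//.
have : (EE (X 0%N) <= 1%:E)%E.
  have <- : (EE (cst 1 : Omega -> R) = 1)%E.
    exact: mean_cst.
  by apply: mean_le => // w; case/andP: (X01 0 w).
have : (0 <= EE (X 0%N))%E.
  by apply: integral_ge0 => w _; rewrite lee_fin; case/andP: (X01 0 w).
by case: (EE (X 0%N)).
Qed.

Lemma mean01 : 0 <= theta <= 1.
Proof.
rewrite -!lee_fin -mean_reward integral_ge0/=; last first.
  by move=> w _; rewrite lee_fin; case/andP: (X01 0 w).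
have <- : (EE (cst 1 : Omega -> R) = 1)%E.
  exact: mean_cst.
by apply: mean_le => // w; case/andP: (X01 0 w).
Qed.

Lemma mgf_bound (s : R) : `|s| <= 1 / 2 ->
  (EE (fun w => expR (s * (X 0%N w - theta))) <= (expR (2 * s ^+ 2))%:E)%E.
Proof.
have [s0|s0] := leP 0 s.
  rewrite ger0_norm// => s12; apply: mgf_ge0 => //; first exact: mean_reward.
  by rewrite s0.
rewrite ltr0_norm// => s12.
pose Z w := 1 - X 0%N w.
have mZ : measurable_fun setT Z by exact: measurable_funB.
have Z01 w : 0 <= Z w <= 1 by rewrite /Z; have := X01 0 w; lra.
have EZ : EE Z = (1 - theta)%:E.
  have : (EE Z + EE (X 0%N) = 1%:E)%E.
    rewrite -meanD//; first last.
    - by move=> w; case/andP: (X01 0 w).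
    - by move=> w; case/andP: (Z01 w).
    rewrite (_ : (fun _ => _) = cst 1%:E).
      exact: mean_cst.
    by apply/funext => w /=; rewrite /Z subrK.
  rewrite mean_reward; case: (EE Z) => [z| |]//= [<-].
  by rewrite addrK.
have := @mgf_ge0 Z (1 - theta) (- s) mZ Z01 EZ; rewrite sqrrN.
rewrite ltW ?oppr_gt0//= => /(_ s12); apply: le_trans.
rewrite le_eqVlt; apply/orP; left; apply/eqP; apply: eq_integral => w _.
by congr (expR _)%:E; rewrite /Z; lra.
Qed.

Lemma prod_indic (J : seq nat) (A : nat -> set Omega) w :
  \prod_(j <- J) \1_(A j) w = \1_(\bigcap_(j in [set j | j \in J]) A j) w :> R.
Proof.
rewrite [RHS]indicE; case: (boolP (w \in _)) => H.
  rewrite big_seq big1// => j jJ; rewrite indicE; rewrite inE in H.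
  by rewrite (mem_set (H j jJ)).
apply/eqP; rewrite prodf_seq_eq0 /=; apply/hasP.
apply: contrapT => H'; move/negP: H; apply; rewrite inE => j /= jJ.
apply: contrapT => nA; apply: H'; exists j => //.
by rewrite indicE memNset.
Qed.

(** Independence is available only as a product rule for events, so exponential factors are
    introduced one at a time. The indicators of later variables are carried along for the induction:
    the hypothesis for [m :: J] bounds the mean against every event about [X m], and
    [mean_comparison] upgrades these events to the exponential of [X m]. *)
Lemma mgf_prod (s : R) m (J : seq nat) (B : nat -> set R) : `|s| <= 1 / 2 ->
  uniq J -> (forall j, j \in J -> (m <= j)%N) -> (forall j, measurable (B j)) ->
  (EE (fun w => (\prod_(k < m) expR (s * (X k w - theta)))
               * \prod_(j <- J) \1_(X j @^-1` B j) w)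
   <= (expR (2 * s ^+ 2) ^+ m * \prod_(j <- J) fine (P (X j @^-1` B j)))%:E)%E.
Proof.
move=> s12.
have /andP[t0 t1] := mean01.
have mexp : measurable_fun setT (fun x : R => expR (s * (x - theta))).
  apply: measurableT_comp => //; apply: measurable_funM => //.
  exact: measurable_funB.
have mprod m' : measurable_fun setT (fun w => \prod_(k < m') expR (s * (X k w - theta))).
  under eq_fun do rewrite -big_enum /=.
  apply: measurable_prod => k _.
  exact: (measurableT_comp mexp).
have mind J' (B' : nat -> set R) : (forall j, measurable (B' j)) ->
    measurable_fun setT (fun w => \prod_(j <- J') (\1_(X j @^-1` B' j) w : R)).
  by move=> mB; apply: measurable_prod => k _; apply: measurable_indic; exact: mpre.
have Pfin (B' : nat -> set R) j : measurable (B' j) ->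
    P (X j @^-1` B' j) = (fine (P (X j @^-1` B' j)))%:E.
  by move=> mB; rewrite fineK// fin_num_measure//; exact: mpre.
elim: m J B => [|m IH] J B uJ Jm mB.
  rewrite expr0 mul1r -prodEFin.
  under eq_bigr => j _ do rewrite -Pfin//.
  rewrite -Xindep//.
  under eq_integral do rewrite big_ord0 mul1r prod_indic.
  rewrite integral_indic ?setIT//.
  by apply: fin_bigcap_measurable => [|j _]; [exact: finite_seq|exact: mpre].
pose Y w := (\prod_(k < m) expR (s * (X k w - theta)))
               * \prod_(j <- J) \1_(X j @^-1` B j) w.
pose q := expR (2 * s ^+ 2) ^+ m * \prod_(j <- J) fine (P (X j @^-1` B j)).
have q0 : 0 <= q.
  by rewrite mulr_ge0 ?exprn_ge0 ?expR_ge0// prodr_ge0// => j _; rewrite fine_ge0.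
have mY : measurable_fun setT Y by apply: measurable_funM; [exact: mprod|exact: mind].
have Y0 w : 0 <= Y w.
  by rewrite mulr_ge0// prodr_ge0// => j _; rewrite ?expR_ge0// indicE.
have -> : (fun w => (\prod_(k < m.+1) expR (s * (X k w - theta)) *
    \prod_(j <- J) \1_(X j @^-1` B j) w)%:E) =
    (fun w => (Y w * expR (s * (X m w - theta)))%:E).
  by apply/funext => w; rewrite big_ord_recr /= mulrAC.
apply: (@le_trans _ _ (q%:E * EE (fun w => expR (s * (X 0%N w - theta))))%E).
  (* [X 0] stands in for [X m] by identical distribution; [expR 1] bounds the factor because [s] is
     at most [1 / 2] and [X m - theta] at most 1 in absolute value. *)
  apply: (@mean_comparison _ _ _ P Y (X m) (X 0%N) (fun x => expR (s * (x - theta))) q (expR 1)) => //.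
  - move=> w; rewrite ler_expR; have := X01 m w; move: s12; rewrite ler_norml; nra.
  - move=> B' mB'.
    pose B2 j := if j == m then B' else B j.
    have mB2 j : measurable (B2 j) by rewrite /B2; case: eqP.
    have mJ : m \notin J by apply/negP => /Jm; rewrite ltnn.
    have E j : j \in J -> B2 j = B j.
      by rewrite /B2; case: eqP => // ->; rewrite (negbTE mJ).
    have := IH (m :: J) B2; rewrite /= mJ uJ => /(_ isT).
    have Jm' j : j \in m :: J -> (m <= j)%N.
      by rewrite inE => /orP[/eqP ->//|/Jm/ltnW].
    move=> /(_ Jm' mB2).
    under eq_integral => w _.
      rewrite big_cons (eq_big_seq (fun j => \1_(X j @^-1` B j) w)); last first.
        by move=> j jJ; rewrite E.
      rewrite {1}/B2 eqxx mulrCA [X in X%:E]mulrC -/(Y w).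
      over.
    move=> H; apply: (le_trans H).
    rewrite big_cons (eq_big_seq (fun j => fine (P (X j @^-1` B j)))); last first.
      by move=> j jJ; rewrite E.
    rewrite {1}/B2 eqxx mulrCA mulrC EFinM -/q.
    by rewrite fineK ?Xid// fin_num_measure//; exact: mpre.
rewrite exprSr mulrAC -/q [X in (_ <= X)%E]EFinM lee_wpmul2l ?lee_fin//.
exact: mgf_bound.
Qed.

Definition emp (x : nat -> R) (N : nat) : R := (\sum_(k < N) x k) / N%:R.

Lemma measurable_emp N : measurable_fun setT (fun w => emp (X^~ w) N).
Proof.
apply: measurable_funM => //; under eq_fun do rewrite -big_enum /=.
exact: measurable_sum.
Qed.

(** Markov's inequality for the exponential of the centred sum; the sign of [s] selects the upper or
    the lower tail. *)
Lemma chernoff_side (s a : R) N : `|s| <= 1 / 2 -> (0 < N)%N ->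
  (P [set w | (`|s| * a <= s * (emp (X^~ w) N - theta))%R]
    <= (expR (2 * s ^+ 2 * N%:R - `|s| * a * N%:R))%:E)%E.
Proof.
move=> s12 N0; set A := [set _ | _].
have mf : measurable_fun setT (fun w => s * (emp (X^~ w) N - theta)).
  by apply: measurable_funM => //; apply: measurable_funB => //; exact: measurable_emp.
have mA : measurable A.
  rewrite -[A]setTI.
  have -> : A = (fun w => s * (emp (X^~ w) N - theta)) @^-1` `[(`|s| * a), +oo[.
    by apply/seteqP; split => w /=; rewrite in_itv /= andbT.
  exact: mf.
have mprod : measurable_fun setT (fun w => \prod_(k < N) expR (s * (X k w - theta))).
  under eq_fun do rewrite -big_enum /=.
  apply: measurable_prod => k _; apply: measurableT_comp => //.
  by apply: measurable_funM => //; exact: measurable_funB.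
have -> : P A = EE (\1_A : Omega -> R) by rewrite integral_indic ?setIT.
apply: (@le_trans _ _ (EE (fun w => expR (- (`|s| * a * N%:R)) *
    \prod_(k < N) expR (s * (X k w - theta))))).
  apply: mean_le.
  - exact: measurable_indic.
  - exact: measurable_funM.
  - by move=> w; rewrite indicE.
  - move=> w; rewrite indicE; case: (boolP (w \in A)) => [|_] /=; last first.
      by rewrite mulr_ge0 ?expR_ge0// prodr_ge0// => k _; exact: expR_ge0.
    rewrite inE /A /= => H; rewrite -expR_sum -expRD -[X in X <= _]expR0 ler_expR.
    rewrite addrC subr_ge0 -mulr_sumr sumrB sumr_const card_ord.
    have NR : 0 < N%:R :> R by rewrite ltr0n.
    have -> : \sum_(k < N) X k w - theta *+ N = (emp (X^~ w) N - theta) * N%:R.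
      by rewrite /emp mulrBl divfK ?lt0r_neq0// mulr_natr.
    by rewrite mulrA ler_wpM2r// ltW.
rewrite meanZ ?expR_ge0//; last first.
  by move=> w; rewrite prodr_ge0// => k _; exact: expR_ge0.
have := @mgf_prod s N [::] (fun=> setT) s12 isT _ (fun=> measurableT).
rewrite big_nil mulr1; under eq_integral do rewrite big_nil mulr1.
move=> /(_ (fun j h => False_ind _ (Bool.diff_false_true h))) H.
apply: le_trans (lee_wpmul2l _ H) _; first by rewrite lee_fin expR_ge0.
by rewrite -EFinM -expRM_natr -expRD addrC.
Qed.

(** The two tails are taken at [s = a / 4] and [s = - a / 4], which minimise the exponent
    [2 * s ^+ 2 * N - |s| * a * N]; its value there is [- a ^+ 2 * N / 8]. *)
Lemma chernoff_emp (a : R) N : 0 < a <= 1 -> (0 < N)%N ->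
  (P [set w | (a < `|emp (X^~ w) N - theta|)%R] <= (2 * expR (- (a ^+ 2 * N%:R / 8)))%:E)%E.
Proof.
move=> /andP[a0 a1] N0.
have na (b : R) : `|b| = a -> `|b / 4| = a / 4 by move=> H; rewrite normrM H ger0_norm.
have side (b : R) : `|b| = a ->
    (P [set w | (a / 4 * a <= b / 4 * (emp (X^~ w) N - theta))%R]
       <= (expR (- (a ^+ 2 * N%:R / 8)))%:E)%E.
  move=> ba; rewrite -(na b ba); apply: (le_trans (chernoff_side _ _ N0)).
    by rewrite na//; lra.
  rewrite lee_fin ler_expR na// exprMn -[b ^+ 2]real_normK ?num_real// ba le_eqVlt.
  by apply/orP; left; apply/eqP; field.
pose A b := [set w | a / 4 * a <= b / 4 * (emp (X^~ w) N - theta)].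
have mA b : measurable (A b).
  rewrite -[A b]setTI.
  have -> : A b = (fun w => b / 4 * (emp (X^~ w) N - theta)) @^-1` `[(a / 4 * a), +oo[.
    by apply/seteqP; split => w /=; rewrite in_itv /= andbT.
  apply: measurable_funM => //; apply: measurable_funB => //; exact: measurable_emp.
apply: (@le_trans _ _ (P (A a `|` A (- a)))).
  apply: le_measure; rewrite ?inE; last 2 first.
  - exact: measurableU.
  - move=> w /=; rewrite lter_normr => /orP[] H; [left|right]; rewrite /A /=; nra.
  rewrite -[X in measurable X]setTI.
  have -> : [set w | a < `|emp (X^~ w) N - theta|] =
     (fun w => `|emp (X^~ w) N - theta|) @^-1` `]a, +oo[.
    by apply/seteqP; split => w /=; rewrite in_itv /= andbT.
  apply: measurableT_comp => //; apply: measurable_funB => //; exact: measurable_emp.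
apply: le_trans (measureU2 _ _ _) _ => //.
by rewrite mulr_natl mulr2n EFinD leeD//; apply: side; rewrite ?normrN ger0_norm// ltW.
Qed.

End Chernoff.

(** * Markov's inequality for weighted counts of events *)

Section Weighted.
Local Open Scope classical_set_scope.
Context d (Omega : measurableType d) (R : realType) (P : probability Omega R).

(** The weights serve to impose several counting requirements at once: if each event of some kind
    has weight at least [v], a total below 1 leaves fewer than [1 / v] of them. *)
Lemma weighted_markov (L : finType) (E : L -> set Omega) (w p : L -> R) (delta : R) :
  (forall l, measurable (E l)) -> (forall l, 0 <= w l) ->
  (forall l, (P (E l) <= (p l)%:E)%E) ->
  \sum_l w l * p l <= delta ->
  exists A : set Omega, measurable A /\ ((1 - delta)%:E <= P A)%E /\
    forall o, A o -> \sum_l w l * \1_(E l) o < 1.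
Proof.
move=> mE w0 pE sum.
pose W o := \sum_(l <- enum L) w l * \1_(E l) o.
have mwE l : measurable_fun setT (fun o => w l * \1_(E l) o).
  by apply: measurable_funM => //; exact: measurable_indic.
have mW : measurable_fun setT W by exact: measurable_sum.
have W0 l o : 0 <= w l * \1_(E l) o by rewrite mulr_ge0// indicE.
pose B := [set o | 1 <= W o].
have mB : measurable B.
  rewrite -[B]setTI; have -> : B = W @^-1` `[1, +oo[.
    by apply/seteqP; split => o /=; rewrite in_itv /= andbT.
  exact: mW.
exists (~` B); split; first exact: measurableC.
split; last first.
  by move=> o; rewrite /B /= => /negP; rewrite -ltNge /W big_enum.
rewrite probability_setC// EFinB leeB//.
have -> : P B = (\int[P]_o (\1_B o)%:E)%E by rewrite integral_indic ?setIT.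
apply: (@le_trans _ _ (\int[P]_o (W o)%:E)%E).
  apply: mean_le => //.
  - by move=> o; rewrite indicE; case: (boolP (o \in B)); rewrite ?inE// => _; exact: sumr_ge0.
rewrite mean_sum// big_enum /=.
apply: (@le_trans _ _ (\sum_l (w l * p l)%:E)%E); last by rewrite sumEFin lee_fin.
apply: lee_sum => l _; rewrite meanZ//.
rewrite integral_indic// setIT EFinM; apply: lee_wpmul2l; [by rewrite lee_fin|exact: pE].
Qed.

End Weighted.

(** * Ranking the arms *)

Section TopSets.
Variables (R : realType) (I : finType).
Implicit Types (C : {set I}) (f : I -> R).

Definition by_value f : rel I := fun x y => f y <= f x.

Definition topset m C f : {set I} :=
  locked [set x in take m (sort (by_value f) (enum C))].

Lemma by_value_total f : total (by_value f).
Proof. by move=> x y; rewrite /by_value le_total. Qed.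

Lemma by_value_trans f : transitive (by_value f).
Proof. by move=> y x z xy yz; apply: le_trans yz xy. Qed.

Lemma topset_sub m C f : topset m C f \subset C.
Proof. by rewrite /topset -lock; apply/fintype.subsetP => x; rewrite inE => /mem_take; rewrite mem_sort mem_enum. Qed.

Lemma card_topset m C f : #|topset m C f| = minn m #|C|.
Proof.
rewrite /topset -lock cardsE (card_uniqP _) ?take_uniq ?sort_uniq ?enum_uniq//.
by rewrite size_take size_sort -cardE; case: ltngtP.
Qed.

Lemma topset_max m C f x y :
  x \in topset m C f -> y \in C -> y \notin topset m C f -> f y <= f x.
Proof.
rewrite /topset -lock !inE => xT yC yT.
have := sort_sorted (by_value_total f) (enum C).
rewrite -[X in sorted _ X](cat_take_drop m) sorted_pairwise; last exact: by_value_trans.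
rewrite pairwise_cat => /and3P[/allrelP H _ _]; apply: H => //.
have : y \in sort (by_value f) (enum C) by rewrite mem_sort mem_enum.
by rewrite -[X in y \in X](cat_take_drop m) mem_cat (negbTE yT).
Qed.

Lemma topset_ge m C f a i : (m <= #|[set j in C | (a <= f j)%R]|)%N ->
  i \in topset m C f -> a <= f i.
Proof.
move=> mC iT; rewrite leNgt; apply/negP => fia.
have sub : i |: [set j in C | (a <= f j)%R] \subset topset m C f.
  rewrite finset.subUset finset.sub1set iT /=; apply/fintype.subsetP => j; rewrite inE => /andP[jC aj].
  apply: contraT => jT; have := topset_max iT jC jT.
  by rewrite leNgt (lt_le_trans fia aj).
have := subset_leq_card sub; rewrite cardsU1 inE card_topset (leNgt a) fia /= andbF /=.
by rewrite ltnNge (leq_trans (geq_minl _ _) mC).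
Qed.

Lemma topset_id m C f : (#|C| <= m)%N -> topset m C f = C.
Proof.
move=> Cm; apply/eqP; rewrite eqEcard topset_sub /= card_topset.
by rewrite leq_min Cm leqnn.
Qed.

End TopSets.

(* The data of an instance used by the analysis: [Top] is a set of [K] best arms,
   [dl i] the gap of arm [i], [thK] the [K]-th largest mean. *)
Record ranked (R : realType) (n K : nat) (eps : R) (theta dl : 'I_n -> R)
    (Top : {set 'I_n}) (thK Ps : R) (t : nat) : Prop := Ranked {
  rk_theta : forall i, 0 <= theta i <= 1;
  rk_card : #|Top| = K;
  rk_gap : forall i, 0 <= dl i <= 1;
  rk_gap_top : forall p q, p \in Top -> q \notin Top -> dl p <= theta p - theta q;
  rk_gap_bot : forall q, q \notin Top -> dl q = thK - theta q;
  rk_top : forall p, p \in Top -> thK <= theta p;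
  rk_Psi : Ps <= 1;
  rk_tK : (t < K)%N;
  rk_tPsi : t%:R * Ps <= K%:R * eps;
  rk_count_top : (#|[set i in Top | (dl i < Ps)%R]| <= t)%N;
  rk_count_bot : (#|[set i in ~: Top | (dl i < Ps)%R]| <= t)%N }.

Section Ranking.
Variables (R : realType) (n K : nat) (theta : 'I_n -> R) (eps : R).
Hypothesis theta01 : forall i, 0 <= theta i <= 1.
Hypotheses (K0 : (0 < K)%N) (Kn : (K.*2 <= n)%N) (eps0 : 0 < eps).

Let arms : seq 'I_n := sort (by_value theta) (enum 'I_n).
Let sm := sorted_mean theta.

Let n0 : (0 < n)%N. Proof. lia. Qed.
Let i0 : 'I_n := Ordinal n0.

Lemma size_arms : size arms = n.
Proof. by rewrite size_sort size_enum_ord. Qed.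

Lemma uniq_arms : uniq arms.
Proof. by rewrite sort_uniq enum_uniq. Qed.

Lemma mem_arms i : i \in arms.
Proof. by rewrite mem_sort mem_enum. Qed.

Lemma index_arms i : (index i arms < n)%N.
Proof.
by have : (index i arms < size arms)%N; [rewrite index_mem mem_arms|rewrite size_arms].
Qed.

Lemma sorted_meanE j : (j < n)%N -> sm j.+1 = theta (nth i0 arms j).
Proof.
move=> jn; rewrite /sm /sorted_mean /sorted_means /=.
by rewrite sort_map (nth_map i0) ?size_sort ?size_enum_ord.
Qed.

Lemma sorted_mean_index i : theta i = sm (index i arms).+1.
Proof. by rewrite sorted_meanE ?nth_index ?mem_arms// index_arms. Qed.

Lemma sorted_mean_le a b : (0 < a <= b)%N -> (b <= n)%N -> sm b <= sm a.
Proof.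
case: a b => [//|a] [|b]; first by rewrite ltn0 andbF.
rewrite /= ltnS => ab bn; rewrite !sorted_meanE//; last exact: leq_ltn_trans bn.
have so := sort_sorted (by_value_total theta) (enum 'I_n).
have rf : reflexive (by_value theta) by move=> x; exact: lexx.
apply: (sorted_leq_nth (@by_value_trans _ _ theta) rf i0 so) => //.
- by rewrite inE size_arms (leq_ltn_trans ab).
- by rewrite inE size_arms.
Qed.

(** Ties are broken by the position in [arms], here and in [arm_gap], so that there are exactly [K]
    top arms and each arm receives the gap of its rank. *)
Definition top_arms : {set 'I_n} := [set i in take K arms].
Definition arm_gap (i : 'I_n) : R := gap K theta (index i arms).+1.

Lemma mem_top i : (i \in top_arms) = (index i arms < K)%N.
Proof.
rewrite inE; apply/idP/idP => [iK|iK].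
  rewrite -[arms](cat_take_drop K) index_cat iK.
  by apply: leq_trans (geq_minl K (size arms)); rewrite -size_take_min index_mem.
by rewrite -[i](nth_index i0 (mem_arms i)) -(nth_take i0 iK) mem_nth// size_take_min leq_min iK size_arms index_arms.
Qed.

Lemma gap_top j : (j <= K)%N -> gap K theta j = sm j - sm K.+1.
Proof. by rewrite /gap => ->. Qed.

Lemma gap_bot j : (K < j)%N -> gap K theta j = sm K - sm j.
Proof. by rewrite /gap ltnNge => /negbTE ->. Qed.

Lemma sm01 j : (0 < j <= n)%N -> 0 <= sm j <= 1.
Proof. by case: j => [//|j] /= jn; rewrite sorted_meanE. Qed.

Lemma gap01 j : (0 < j <= n)%N -> 0 <= gap K theta j <= 1.
Proof.
move=> jn; have := sm01 jn.
have K1n : (K.+1 <= n)%N by lia.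
have [jK|Kj] := leqP j K.
- rewrite gap_top// => /andP[a0 a1].
  have /andP[b0 b1] := @sm01 K.+1 K1n.
  have /= := @sorted_mean_le j K.+1; rewrite (leqW jK) andbT; case/andP: (jn) => -> _ /(_ isT K1n).
  lra.
- rewrite gap_bot// => /andP[a0 a1].
  have Kn' : (0 < K <= n)%N by lia.
  have /andP[b0 b1] := sm01 Kn'.
  have := @sorted_mean_le K j; rewrite K0 (ltnW Kj) => /(_ isT); case/andP: (jn) => _ -> /(_ isT).
  lra.
Qed.

(** [t = 0] always qualifies, so the maximum is attained by an admissible [t] instead of being the
    default value of an empty maximum. *)
Lemma t_cond_eps : t_cond K theta eps (t_eps K theta eps).
Proof.
rewrite /t_eps.
have C : (0 < #|[pred t : 'I_K | t_cond K theta eps t]|)%N.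
  apply/card_gt0P; exists (Ordinal K0); rewrite inE /t_cond /= !mulr0.
  by rewrite mulr_ge0 ?ler0n// ltW.
by have [t Ht ->] := @eq_bigmax_cond _ _ (fun t : 'I_K => nat_of_ord t) C.
Qed.

Lemma t_eps_lt : (t_eps K theta eps < K)%N.
Proof.
rewrite /t_eps -[X in (_ < X)%N](prednK K0) ltnS; apply/bigmax_leqP => t _.
by rewrite -ltnS prednK.
Qed.

(** Gaps grow with the distance from the cut. As [Psi] is at most the gaps of ranks [K - t] and
    [K + t + 1], an arm with a smaller gap is among the last [t] top arms or the first [t]
    others. *)
Lemma ranked_instance :
  ranked K eps theta arm_gap top_arms (sm K) (Psi K theta (t_eps K theta eps))
    (t_eps K theta eps).
Proof.
have tK := t_eps_lt; set t := t_eps K theta eps in tK *.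
have /andP[tc1 tc2] : t_cond K theta eps t := t_cond_eps.
have idx i : (0 < (index i arms).+1 <= n)%N by rewrite /= index_arms.
split => //.
- by rewrite cardsE (card_uniqP _) ?take_uniq ?uniq_arms// size_take_min size_arms; lia.
- by move=> i; exact: gap01.
- move=> p q; rewrite !mem_top -leqNgt => pK Kq.
  rewrite /arm_gap gap_top// (sorted_mean_index p) (sorted_mean_index q).
  have := @sorted_mean_le K.+1 (index q arms).+1; rewrite /= ltnS Kq index_arms => /(_ isT isT).
  lra.
- move=> q; rewrite mem_top -leqNgt => Kq.
  by rewrite /arm_gap gap_bot// -sorted_mean_index.
- move=> p; rewrite mem_top => pK; rewrite (sorted_mean_index p).
  by apply: sorted_mean_le; rewrite ?pK//; lia.
- rewrite /Psi ge_min; have /andP[_ ->//] : 0 <= gap K theta (K - t) <= 1.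
  by apply: gap01; lia.
- rewrite mulrC; apply: le_trans tc1; rewrite ler_wpM2r ?ler0n//.
  by rewrite /Psi ge_min lexx.
- apply: (@leq_trans #|[set i in drop (K - t) (take K arms)]|).
    apply: subset_leq_card; apply/fintype.subsetP => i; rewrite !inE => /andP[iK lt].
    have iK' : (index i arms < K)%N by rewrite -mem_top inE.
    move: iK; rewrite -[X in i \in X](cat_take_drop (K - t)) mem_cat.
    case/orP => //; rewrite take_takel ?leq_subr// => /index_ltn iKt.
    exfalso; move: lt; rewrite ltNge => /negP; apply.
    rewrite /Psi ge_min /arm_gap; apply/orP; left.
    rewrite !gap_top ?leq_subr// lerD2r; apply: sorted_mean_le; [exact: iKt|lia].
  rewrite cardsE; apply: leq_trans (card_size _) _.
  by rewrite size_drop size_take_min size_arms; lia.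
- apply: (@leq_trans #|[set i in take t (drop K arms)]|).
    apply: subset_leq_card; apply/fintype.subsetP => i; rewrite !inE => /andP[iK lt].
    have iK' : (K <= index i arms)%N by rewrite leqNgt -mem_top inE.
    have : i \in arms by exact: mem_arms.
    rewrite -[X in i \in X](cat_take_drop K) mem_cat (negbTE iK) /=.
    rewrite -[X in i \in X](cat_take_drop t) mem_cat.
    case/orP => //; rewrite drop_drop => iD.
    exfalso; move: lt; rewrite ltNge => /negP; apply.
    have tki : (t + K <= index i arms)%N.
      rewrite leqNgt; apply/negP => iT.
      have iT' : i \in take (t + K) arms.
        by rewrite -[i](nth_index i0 (mem_arms i)) -(nth_take i0 iT) mem_nth// size_take_min leq_min iT size_arms index_arms.
      have := uniq_arms; rewrite -[arms](cat_take_drop (t + K)) cat_uniq.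
      by case/and3P => _ /hasPn /(_ _ iD) /=; rewrite iT'.
    rewrite /Psi ge_min /arm_gap; apply/orP; right.
    rewrite !gap_bot; rewrite ?ltnS//; try lia.
    rewrite lerB//; apply: sorted_mean_le; [by rewrite addn1 /= ltnS addnC|exact: index_arms].
  rewrite cardsE; apply: leq_trans (card_size _) _.
  by rewrite size_take_min geq_minl.
Qed.

Lemma complexity_arms : H_complexity K theta eps =
  \sum_i min_inv_sq (arm_gap i) (Num.max eps (Psi K theta (t_eps K theta eps))).
Proof.
rewrite /H_complexity -/(Psi_eps K theta eps (t_eps K theta eps)).
set Q := Psi_eps _ _ _ _.
rewrite big_add1 /= -[X in \sum_(0 <= i < X) _]size_arms.
rewrite (eq_big_nat _ _ (F2 := fun j => min_inv_sq (arm_gap (nth i0 arms j)) Q)); last first.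
  by move=> j /andP[_ jn]; rewrite /arm_gap index_uniq ?uniq_arms.
rewrite -(big_nth i0 xpredT (fun i => min_inv_sq (arm_gap i) Q)) -[RHS]big_enum /=.
by apply: perm_big; rewrite perm_sort.
Qed.

Lemma regret_arms (T : {set 'I_n}) : agg_regret K theta T =
  (\sum_(i in top_arms) theta i - \sum_(i in T) theta i) / K%:R.
Proof.
rewrite /agg_regret; congr ((_ - _) / _).
have Kl : (K <= size arms)%N by rewrite size_arms; lia.
rewrite big_add1 /= -[X in \sum_(0 <= i < X) _](size_takel Kl).
rewrite (eq_big_nat _ _ (F2 := fun j => theta (nth i0 (take K arms) j))); last first.
  move=> j /andP[_]; rewrite size_takel// => jK.
  by rewrite nth_take// -sorted_meanE//; lia.
rewrite -(big_nth i0 xpredT theta) big_uniq ?take_uniq ?uniq_arms//=.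
by apply: eq_bigl => i; rewrite inE.
Qed.

End Ranking.

(** * Accept and reject phases *)

Section Counting.
Variables (R : realType) (I : finType).

Lemma card_le_cover (W U V : {set I}) u v :
  W \subset U :|: V -> (#|U| <= u)%N -> (#|V| <= v)%N -> (#|W| <= u + v)%N.
Proof.
move=> /subset_leq_card H Uu Vv; apply: leq_trans H _.
by apply: leq_trans (leq_card_setU U V) _; exact: leq_add.
Qed.

Lemma sum_exceptions (W Exc : {set I}) (f : I -> R) (x : R) : 0 <= x ->
  (forall i, i \in W -> i \notin Exc -> f i <= x) ->
  (forall i, i \in W -> f i <= 1) ->
  \sum_(i in W) f i <= x * #|W|%:R + #|W :&: Exc|%:R.
Proof.
move=> x0 Hx H1.
have -> : #|W :&: Exc|%:R = \sum_(i in W) (i \in Exc)%:R :> R.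
  rewrite -sum1_card natr_sum big_mkcond [RHS]big_mkcond /=; apply: eq_bigr => i _.
  by rewrite inE; case: (i \in W); case: (i \in Exc).
rewrite mulr_natr -sumr_const -big_split /= ler_sum// => i iW.
have [iE|iE] := boolP (i \in Exc).
  by rewrite (le_trans (H1 _ iW))// lerDr.
by rewrite addr0; exact: Hx.
Qed.

(** Any [c] may be subtracted since the two differences have equal size. Regret bounds choose it
    near the means of the confused arms, so that only deviations from [c] count. *)
Lemma sum_setD (T U : {set I}) (f : I -> R) (c : R) : #|T| = #|U| ->
  \sum_(i in T) f i - \sum_(i in U) f i =
  \sum_(i in T :\: U) (f i - c) - \sum_(i in U :\: T) (f i - c).
Proof.
move=> TU.
have split (V W : {set I}) : \sum_(i in V) f i = \sum_(i in V :&: W) f i + \sum_(i in V :\: W) f i.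
  by rewrite (big_setID W).
have cD : #|T :\: U| = #|U :\: T|.
  by have := cardsID U T; have := cardsID T U; rewrite finset.setIC; lia.
rewrite (split T U) (split U T) [U :&: T]finset.setIC !sumrB !sumr_const cD; lra.
Qed.

End Counting.

(** * One accept and reject phase with unreliable arms *)

Section SmallStep.
Variables (R : realType) (n : nat).
Implicit Types (S Y : {set 'I_n}) (e : 'I_n -> R) (g : R).

(** The margin [g / 2] exceeds twice the accuracy [g / 16], so a reliable accepted arm is truly
    better than every reliable arm across the cut. *)
Definition accepted Y S e g : {set 'I_n} :=
  [set i in Y | [forall q in S :\: Y, e q + g / 2 < e i]].
Definition rejected Y S e g : {set 'I_n} :=
  [set i in S :\: Y | [forall q in Y, e i < e q - g / 2]].

Variables (K : nat) (eps : R) (theta dl : 'I_n -> R) (Top : {set 'I_n}).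
Variables (thK Ps : R) (t : nat).
Hypothesis rk : ranked K eps theta dl Top thK Ps t.
Variables (B : {set 'I_n}) (b D : nat).
Hypothesis Bb : (#|B| <= b)%N.
Variables (A S : {set 'I_n}) (e : 'I_n -> R) (g : R).
Hypotheses (AS : [disjoint A & S]) (AK : (#|A| < K)%N) (KS : (K - #|A| < #|S|)%N).
Hypothesis good : forall i, i \in S -> i \notin B -> `|e i - theta i| <= g / 16.
Hypothesis e01 : forall i, i \in S -> 0 <= e i <= 1.
Hypotheses (g0 : 0 < g) (g1 : g <= 1).
Hypothesis AD : (#|A :\: Top| <= D)%N.
Hypothesis CD : (#|Top :\: (A :|: S)| <= D)%N.

Let k := (K - #|A|)%N.
Let Y := topset k S e.
Let acc := accepted Y S e g.
Let rej := rejected Y S e g.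
Let A' := A :|: acc.
Let S' := S :\: (acc :|: rej).
Let k' := (K - #|A'|)%N.
Let mn := minn k' (#|S'| - k').

Let YS : Y \subset S. Proof. exact: topset_sub. Qed.
Let cY : #|Y| = k. Proof. by rewrite card_topset; apply/minn_idPl; exact: ltnW. Qed.
Let accY : acc \subset Y.
Proof. by apply/fintype.subsetP => i; rewrite inE => /andP[]. Qed.
Let rejSY : rej \subset S :\: Y.
Proof. by apply/fintype.subsetP => i; rewrite inE => /andP[]. Qed.

Let inS' i : i \in S' -> i \in S.
Proof. by rewrite inE => /andP[]. Qed.

Let S'sub i : i \in S' = [&& i \in S, i \notin acc & i \notin rej].
Proof. by rewrite !inE negb_or andbC. Qed.

Let Ymax i j : i \in Y -> j \in S -> j \notin Y -> e j <= e i.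
Proof. exact: topset_max. Qed.

Lemma step_disjoint : [disjoint A' & S'].
Proof.
rewrite disjoint_subset; apply/fintype.subsetP => i.
rewrite !inE => /orP[iA|iacc]; last by rewrite iacc.
have := AS; rewrite disjoint_subset => /fintype.subsetP/(_ _ iA); rewrite inE => /negbTE ->.
by rewrite andbF.
Qed.

Let disjAacc : [disjoint A & acc].
Proof.
by apply: disjointWr AS; apply: fintype.subset_trans accY YS.
Qed.

Let cA' : #|A'| = (#|A| + #|acc|)%N.
Proof. by apply/eqP; rewrite leq_card_setU. Qed.

Let cacc : (#|acc| <= k)%N.
Proof. by rewrite -cY; exact: subset_leq_card. Qed.

Lemma step_card : (#|A'| <= K)%N.
Proof. by rewrite cA'; move: cacc AK; rewrite /k; lia. Qed.

Lemma step_enough : (k' <= #|S'|)%N.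
Proof.
have cSY : (#|S :\: Y| = #|S| - k)%N by rewrite cardsDS// cY.
have crej : (#|rej| <= #|S| - k)%N by rewrite -cSY; exact: subset_leq_card.
have : (#|S :\: S'| <= #|acc| + #|rej|)%N.
  apply: leq_trans (leq_card_setU acc rej); apply: subset_leq_card.
  apply/fintype.subsetP => i; rewrite !inE.
  by case: (i \in S); rewrite ?andbF// !andbT negbK.
have := cardsID S' S.
have -> : S :&: S' = S' by apply/finset.setIidPr; apply/fintype.subsetP => i; exact: inS'.
rewrite /k' cA'; move: KS; rewrite -/k; have : k = (K - #|A|)%N by []; lia.
Qed.

Let goodP i : i \in S -> i \notin B -> theta i - g / 16 <= e i <= theta i + g / 16.
Proof. by move=> iS iB; have := good iS iB; rewrite ler_norml; lra. Qed.

Let G := A :|: Y.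
Let cG : #|G| = K.
Proof.
have : [disjoint A & Y] by apply: disjointWr AS.
rewrite -(leq_card_setU A Y).2 => /eqP ->; rewrite cY.
by move: AK; rewrite /k; lia.
Qed.

Let cGT : #|G :\: Top| = #|Top :\: G|.
Proof.
have := cardsID Top G; have := cardsID G Top.
by rewrite finset.setIC cG (rk_card rk); lia.
Qed.

Lemma gap_gt p q : p \in Top -> q \notin Top -> theta q <= theta p.
Proof.
move=> pT qT; have := rk_gap_top rk pT qT; have /andP[d0 _] := rk_gap rk p; lra.
Qed.

(** If only unreliable arms are wrongly accepted, at most [b] are added. Otherwise one reliable
    wrong arm beats everything outside [Y], so all reliable top arms of [S] lie in [Y]. Then
    [Top :\: G] consists of earlier wrong rejections and unreliable arms, and [G :\: Top] has the
    same size because [G] and [Top] both have [K] elements. Wrong rejections are counted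
    symmetrically. *)
Lemma step_wrong_accept : (#|A' :\: Top| <= D + b)%N.
Proof.
have hg := g0; have hg1 := g1.
have [sub|] := boolP (acc :\: Top \subset B).
  apply: (card_le_cover _ AD (leq_trans (subset_leq_card sub) Bb)).
  by rewrite finset.setDUl.
case/subsetPn => q; rewrite inE => /andP[qT qacc] qB.
have qY := fintype.subsetP accY _ qacc; have qS := fintype.subsetP YS _ qY.
apply: (@leq_trans #|G :\: Top|).
  by apply: subset_leq_card; apply: finset.setSD; apply: finset.setUS.
rewrite cGT; apply: (card_le_cover _ CD Bb).
apply/fintype.subsetP => p; rewrite !inE !negb_or => /andP[/andP[pA pY] pT].
rewrite pA pT /= andbT; have [pS|//] := boolP (p \in S); apply: contraT => /= pB.
have := qacc; rewrite inE => /andP[_ /forall_inP/(_ p)]; rewrite inE pY pS => /(_ isT).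
have := goodP pS pB; have := goodP qS qB; have := gap_gt pT qT; lra.
Qed.

Lemma step_wrong_reject : (#|Top :\: (A' :|: S')| <= D + b)%N.
Proof.
have hg := g0; have hg1 := g1.
have [sub|] := boolP (Top :&: rej \subset B).
  apply: (card_le_cover _ CD (leq_trans (subset_leq_card sub) Bb)).
  apply/fintype.subsetP => p; rewrite finset.in_setU !finset.in_setD finset.in_setI !finset.in_setU S'sub.
  by case: (p \in A); case: (p \in S); case: (p \in Top); case: (p \in acc); case: (p \in rej).
case/subsetPn => p; rewrite inE => /andP[pT prej] pB.
have := fintype.subsetP rejSY _ prej; rewrite inE => /andP[pY pS].
apply: (@leq_trans #|Top :\: G|).
  apply: subset_leq_card; apply: finset.setDS; apply/fintype.subsetP => i.
  rewrite !finset.in_setU S'sub => /orP[->//|iY]; rewrite (fintype.subsetP YS _ iY) /=.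
  have -> : i \notin rej.
    by apply/negP => /(fintype.subsetP rejSY); rewrite inE iY.
  by case: (i \in acc); rewrite ?orbT.
rewrite -cGT finset.setDUl; apply: (card_le_cover (fintype.subxx _) AD).
apply: leq_trans Bb; apply: subset_leq_card.
apply/fintype.subsetP => q; rewrite inE => /andP[qT qY].
have qS := fintype.subsetP YS _ qY; apply: contraT => qB.
have := prej; rewrite inE => /andP[_ /forall_inP/(_ q qY)].
have := goodP pS pB; have := goodP qS qB; have := gap_gt pT qT; lra.
Qed.

(** An undecided arm of [Y] is at most [g / 2] above some arm across the cut, and every arm of [Y]
    dominates that one. *)
Lemma step_low_Y i y : i \in S' -> y \in Y -> e i - g / 2 <= e y.
Proof.
have hg := g0; have hg1 := g1.
move=> iS' yY; move: (iS'); rewrite S'sub => /and3P[iS iacc irej].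
have [iY|iY] := boolP (i \in Y); last first.
  have := Ymax yY iS iY; lra.
move: iacc; rewrite inE iY /= negb_forall_in => /exists_inP[q].
rewrite inE -leNgt => /andP[qY qS]; have := Ymax yY qS qY; lra.
Qed.

Lemma step_high_notY i z : i \in S' -> z \in S -> z \notin Y -> e z <= e i + g / 2.
Proof.
have hg := g0; have hg1 := g1.
move=> iS' zS zY; move: (iS'); rewrite S'sub => /and3P[iS iacc irej].
have [iY|iY] := boolP (i \in Y).
  have := Ymax iY zS zY; lra.
move: irej; rewrite !inE iY iS /= negb_forall_in => /exists_inP[q qY].
rewrite -leNgt; have := Ymax qY zS zY; lra.
Qed.

(** A reliable arm [q] outside [Top] is estimated far below [i]. All of [Y] is within [g / 2] of [i]
    from below or higher, so [q] is not in [Y] and loses to all of [Y] by the margin: it has been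
    rejected. *)
Lemma step_bottoms_gone i : i \in S' -> i \notin B -> i \in Top -> 4 * g < dl i ->
  S' :\: Top \subset B.
Proof.
have hg := g0; have hg1 := g1.
move=> iS' iB iT dg; apply/fintype.subsetP => q; rewrite inE => /andP[qT qS'].
apply: contraT => qB.
have := goodP (inS' iS') iB; have := goodP (inS' qS') qB; have := rk_gap_top rk iT qT.
move=> h1 h2 h3; exfalso.
have qY : q \notin Y by apply/negP => qY; have := step_low_Y iS' qY; lra.
move: (qS'); rewrite S'sub => /and3P[qS _ /negP]; apply.
rewrite !inE qY qS /=; apply/forall_inP => y yY; have := step_low_Y iS' yY; lra.
Qed.

Lemma step_tops_gone i : i \in S' -> i \notin B -> i \notin Top -> 4 * g < dl i ->
  S' :&: Top \subset B.
Proof.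
have hg := g0; have hg1 := g1.
move=> iS' iB iT dg; apply/fintype.subsetP => q; rewrite inE => /andP[qS' qT].
apply: contraT => qB.
have := goodP (inS' iS') iB; have := goodP (inS' qS') qB.
have := rk_gap_bot rk iT; have := rk_top rk qT.
move=> h0 h1 h2 h3; exfalso.
have qY : q \in Y.
  by apply: contraT => qY; have := step_high_notY iS' (inS' qS') qY; lra.
move: (qS'); rewrite S'sub => /and3P[qS /negP + _]; apply.
rewrite !inE qY /=; apply/forall_inP => y; rewrite inE => /andP[yY yS].
have := step_high_notY iS' yS yY; lra.
Qed.

Lemma step_few_tops m : (#|S' :&: Top| <= m)%N -> (k' <= m + (D + b))%N.
Proof.
move=> Hm; have wr := step_wrong_reject.
have : (#|Top| <= #|A'| + (m + (D + b)))%N.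
  apply: (card_le_cover (U := A') (V := (S' :&: Top) :|: (Top :\: (A' :|: S')))) => //.
    move: (A') (S') => A1 S1; apply/fintype.subsetP => i iT; rewrite !inE iT.
    by case: (i \in S1); case: (i \in A1).
  exact: card_le_cover (fintype.subxx _) Hm wr.
by rewrite (rk_card rk) /k'; lia.
Qed.

(** Used in contrapositive form: while the procedure goes on, every reliable undecided arm has gap
    at most [4 * g], so its next estimate is paid for by its own term of [H]. *)
Lemma step_gap_stop i : i \in S' -> i \notin B -> 4 * g < dl i -> (mn <= D + b + b)%N.
Proof.
move=> iS' iB dg; rewrite /mn geq_min.
have [iT|iT] := boolP (i \in Top); apply/orP; [right|left]; last first.
  have sub := step_tops_gone iS' iB iT dg.
  by rewrite addnC; exact: step_few_tops (leq_trans (subset_leq_card sub) Bb).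
have sub := leq_trans (subset_leq_card (step_bottoms_gone iS' iB iT dg)) Bb.
have wa := step_wrong_accept; have c1 := cardsID Top S'; have c2 := cardsID Top A'.
have arith (s st sd a at' ad N : nat) : (st + sd = s -> at' + ad = a -> ad <= D + b ->
    sd <= b -> a <= N -> st + at' <= N -> s - (N - a) <= D + b + b)%N by clear; lia.
apply: (arith _ _ _ _ _ _ _ c1 c2 wa sub step_card).
rewrite -(rk_card rk) addnC.
have dis : [disjoint A' :&: Top & S' :&: Top].
  by apply: disjointWl (finset.subsetIl _ _) _; apply: disjointWr (finset.subsetIl _ _) step_disjoint.
move: dis; rewrite -(leq_card_setU _ _).2 => /eqP <-; apply: subset_leq_card.
by rewrite -finset.setIUl finset.subsetIr.
Qed.

Lemma step_Psi_stop : (forall i, i \in S' -> i \notin B -> dl i < Ps) ->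
  (mn <= t + (D + b + b))%N.
Proof.
move=> H; rewrite /mn geq_min; apply/orP; left.
have : (#|S' :&: Top| <= b + t)%N.
  apply: (card_le_cover _ Bb (rk_count_top rk)).
  apply/fintype.subsetP => i; rewrite inE => /andP[iS' iT].
  rewrite !inE iT /=; have [//|iB] := boolP (i \in B); exact: H.
have arith (x : nat) : (x <= b + t + (D + b) -> x <= t + (D + b + b))%N by clear; lia.
by move=> /step_few_tops /arith.
Qed.

(** The centre is the best estimate across the cut: undecided arms have estimates within [g / 2] of
    it, and reliability adds [g / 16]. Its lying in [[0, 1]] keeps the contribution of exceptional
    arms at most 1. *)
Lemma step_center : exists c : R, 0 <= c <= 1 /\
  forall i, i \in S' -> i \notin B -> `|theta i - c| <= 9 / 16 * g.
Proof.
have hg := g0; have hg1 := g1.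
have [z0 z0SY] : exists z, z \in S :\: Y.
  by apply/set0Pn; rewrite -card_gt0 cardsDS// cY subn_gt0.
case: (@arg_maxP _ _ _ z0 (fun z => z \in S :\: Y) e z0SY) => z; rewrite !inE => /andP[zY zS] zmax.
exists (e z); split; first exact: e01.
move=> i iS' iB; have := goodP (inS' iS') iB => gi.
have hi := step_high_notY iS' zS zY.
have : e i <= e z + g / 2.
  move: (iS'); rewrite S'sub => /and3P[iS iacc irej].
  have [iY|iY] := boolP (i \in Y).
    move: iacc; rewrite inE iY /= negb_forall_in => /exists_inP[q qSY].
    rewrite -leNgt => qe; have : e q <= e z := zmax _ qSY; lra.
  have : e i <= e z by apply: (zmax i); rewrite !inE iY iS.
  lra.
by rewrite ler_norml; lra.
Qed.

(** Any completion [Z] works, since reliable undecided arms are nearly equal. On each side of the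
    symmetric difference, of size at most [D + b + mn], such an arm costs [9 / 16 * g] and each of
    at most [D + 2 * b] exceptions costs 1 more. *)
Lemma step_regret (Z : {set 'I_n}) : Z \subset S' -> #|Z| = k' ->
  #|A' :|: Z| = K /\
  \sum_(i in Top) theta i - \sum_(i in A' :|: Z) theta i
    <= 9 / 8 * (g * mn%:R) + 4 * D%:R + 6 * b%:R.
Proof.
have hg := g0; have hg1 := g1.
move=> ZS' cZ; set T := A' :|: Z.
have cT : #|T| = K.
  have : [disjoint A' & Z] by apply: disjointWr step_disjoint.
  rewrite -(leq_card_setU A' Z).2 => /eqP ->; rewrite cZ.
  by have := step_card; rewrite /k'; lia.
split=> //.
have [c [c01 cP]] := step_center.
rewrite (sum_setD theta c (T := Top) (U := T)) ?cT ?(rk_card rk)//.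
set W := Top :\: T; set V := T :\: Top.
have cWV : #|W| = #|V|.
  have := cardsID Top T; have := cardsID T Top.
  have arith (x y z u : nat) : (x + y = u -> x + z = u -> z = y)%N by clear; lia.
  by rewrite finset.setIC cT (rk_card rk) => c1 c2; apply: arith c2 c1.
have cW1 : (#|W| <= (D + b) + (#|S'| - k'))%N.
  rewrite -cZ -(cardsDS ZS').
  apply: (card_le_cover _ step_wrong_reject (leqnn _)).
  rewrite /W /T; move: (A') (S') => A1 S1; apply/fintype.subsetP => i; rewrite !inE.
  by case: (i \in A1); case: (i \in Z); case: (i \in S1); case: (i \in Top).
have cV1 : (#|V| <= (D + b) + k')%N.
  rewrite -cZ; apply: (card_le_cover _ step_wrong_accept (leqnn _)).
  rewrite /V /T; move: (A') => A1; apply/fintype.subsetP => i; rewrite !inE.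
  by case: (i \in A1); case: (i \in Z); case: (i \in Top).
have cWm : (#|W| <= D + b + mn)%N.
  by rewrite /mn addn_minr leq_min cW1 cWV cV1.
pose Exc := B :|: ~: S'.
have cWE : (#|W :&: Exc| <= b + (D + b))%N.
  apply: (card_le_cover _ Bb step_wrong_reject).
  rewrite /W /T /Exc; move: (A') (S') => A1 S1; apply/fintype.subsetP => i; rewrite !inE.
  by case: (i \in A1); case: (i \in Z); case: (i \in S1); case: (i \in Top); case: (i \in B).
have cVE : (#|V :&: Exc| <= b + (D + b))%N.
  apply: (card_le_cover _ Bb step_wrong_accept).
  rewrite /V /T /Exc; move: (A') (S') (fintype.subsetP ZS') => A1 S1 ZS1.
  apply/fintype.subsetP => i; rewrite !inE; move: (ZS1 i).
  case: (i \in A1); case: (i \in Z); case: (i \in S1); case: (i \in Top); case: (i \in B) => //= H; have := H isT.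
have x0 : 0 <= 9 / 16 * g by lra.
have thc i : -1 <= theta i - c <= 1 by have := rk_theta rk i; lra.
have HW : \sum_(i in W) (theta i - c) <= 9 / 16 * g * #|W|%:R + #|W :&: Exc|%:R.
  apply: sum_exceptions => // i iW; last by have := thc i; lra.
  rewrite /Exc finset.in_setU finset.in_setC negb_or negbK => /andP[iB iS'].
  by have := cP i iS' iB; rewrite ler_norml; lra.
have HV : \sum_(i in V) (- (theta i - c)) <= 9 / 16 * g * #|V|%:R + #|V :&: Exc|%:R.
  apply: sum_exceptions => // i iV; last by have := thc i; lra.
  rewrite /Exc finset.in_setU finset.in_setC negb_or negbK => /andP[iB iS'].
  by have := cP i iS' iB; rewrite ler_norml; lra.
rewrite sumrN in HV.
have r1 : #|W|%:R <= D%:R + b%:R + mn%:R :> R by rewrite -!natrD ler_nat.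
have r2 : #|W :&: Exc|%:R <= b%:R + (D%:R + b%:R) :> R by rewrite -!natrD ler_nat.
have r3 : #|V :&: Exc|%:R <= b%:R + (D%:R + b%:R) :> R by rewrite -!natrD ler_nat.
rewrite -cWV in HV.
have h : 9 / 16 * g * #|W|%:R <= 9 / 16 * (g * mn%:R) + (D%:R + b%:R).
  apply: (@le_trans _ _ (9 / 16 * g * (D%:R + b%:R + mn%:R))); first by rewrite ler_wpM2l.
  have : g * (D%:R + b%:R) <= D%:R + b%:R by rewrite ler_piMl// addr_ge0.
  have : 0 <= D%:R + b%:R :> R by rewrite addr_ge0.
  lra.
lra.
Qed.

End SmallStep.

Section Empirical.
Variables (R : realType) (n : nat).

Lemma emp_visible (N : 'I_n -> nat) (X : 'I_n -> nat -> R) i m : (m <= N i)%N ->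
  emp (visible N X i) m = emp (X i) m.
Proof.
move=> mN; rewrite /emp; congr (_ / _); apply: eq_bigr => k _.
by rewrite /visible (leq_trans (ltn_ord k) mN).
Qed.

Lemma emp01 (x : nat -> R) N : (forall k, 0 <= x k <= 1) -> 0 <= emp x N <= 1.
Proof.
move=> x01; have s0 : 0 <= \sum_(k < N) x k.
  by apply: sumr_ge0 => k _; case/andP: (x01 k).
rewrite /emp divr_ge0//=; case: N s0 => [|N] s0; first by rewrite big_ord0 mul0r.
rewrite ler_pdivrMr ?ltr0n// mul1r -[X in _ <= X%:R]card_ord -sum1_card natr_sum.
by apply: ler_sum => k _; case/andP: (x01 k).
Qed.

Definition gam (r : nat) : R := 2^-1 ^+ r.

Lemma gam_gt0 r : 0 < gam r.
Proof. by rewrite exprn_gt0// invr_gt0. Qed.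

Lemma gam_le1 r : gam r <= 1.
Proof. by rewrite exprn_ile1 ?invr_ge0// invf_le1// ler1n. Qed.

End Empirical.

(** * The accept and reject procedure *)

Section SmallAlgorithm.
Variables (R : realType) (n K : nat) (eps : R) (N : nat -> nat).

Definition small_body (last : bool) (r : nat) (next : {set 'I_n} -> {set 'I_n} -> prog R n)
    (A S : {set 'I_n}) : prog R n :=
  Ask (fun i => if i \in S then N r else 0%N) (fun X =>
    let e := fun i => emp (X i) (N r) in
    let Y := topset (K - #|A|) S e in
    let A' := A :|: accepted Y S e (gam R r) in
    let S' := S :\: (accepted Y S e (gam R r) :|: rejected Y S e (gam R r)) in
    let k' := (K - #|A'|)%N in
    if last || ((minn k' (#|S'| - k'))%:R * gam R r <= K%:R * eps / 2)
    then Ret R (A' :|: topset k' S' e) else next A' S').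

(** At zero fuel the flag [last] makes the body return, so the dummy continuation is never
    reached. *)
Fixpoint small_phase (fuel r : nat) : {set 'I_n} -> {set 'I_n} -> prog R n :=
  if fuel is f.+1 then small_body false r (small_phase f r.+1)
  else small_body true r (fun _ _ => Ret R finset.set0).

Variables (theta dl : 'I_n -> R) (Top : {set 'I_n}) (thK Ps : R) (t : nat).
Hypothesis rk : ranked K eps theta dl Top thK Ps t.
Hypothesis eps0 : 0 < eps.
Variables (X : 'I_n -> nat -> R) (rmax : nat) (B : {set 'I_n}) (b : nat) (Bd : 'I_n -> R).
Hypothesis X01 : forall i k, 0 <= X i k <= 1.
Hypothesis rmax_eps : gam R rmax <= eps / 2.
Hypothesis Bb : (#|B| <= b)%N.
Hypothesis b_small : 100 * ((rmax.+1 * b)%:R) <= K%:R * eps.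
Hypothesis good : forall i r, i \notin B -> (r <= rmax)%N ->
  `|emp (X i) (N r) - theta i| <= gam R r / 16.
Hypothesis Bd_bad : forall i r, i \in B -> (r <= rmax)%N -> (N r)%:R <= Bd i.
Hypothesis Bd_step : forall i r, i \notin B -> (r < rmax)%N ->
  dl i <= 4 * gam R r -> Num.max eps Ps <= 4 * gam R r -> (N r.+1)%:R <= Bd i.
Hypothesis Bd0 : forall i, 0 <= Bd i.

(** Every phase adds at most [b] errors of each kind. The last clause says that the estimates about
    to be requested are already within budget. *)
Definition small_inv (r : nat) (A S : {set 'I_n}) : Prop :=
  [/\ [disjoint A & S], (#|A| < K)%N /\ (K - #|A| < #|S|)%N,
      (#|A :\: Top| <= r * b)%N, (#|Top :\: (A :|: S)| <= r * b)%N &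
      forall i, i \in S -> (N r)%:R <= Bd i].

Definition small_good (p : prog R n) : Prop :=
  [/\ #|run p X| = K,
      \sum_(i in Top) theta i - \sum_(i in run p X) theta i <= K%:R * eps &
      forall i, (demand p X i)%:R <= Bd i].

Lemma small_body_correct (last : bool) r next A S : (r <= rmax)%N -> (last -> r = rmax) ->
  (~~ last -> (r < rmax)%N) ->
  (forall A' S', small_inv r.+1 A' S' -> ~~ last -> small_good (next A' S')) ->
  small_inv r A S -> small_good (small_body last r next A S).
Proof.
move=> rr lastE lastN nextP [AS [AK KS] AD CD NB].
rewrite /small_good /small_body /=.
set Xm := visible _ X; set e := fun i => emp (Xm i) (N r).
have ee i : i \in S -> e i = emp (X i) (N r).
  by move=> iS; rewrite /e /Xm emp_visible// iS.
have g i : i \in S -> i \notin B -> `|e i - theta i| <= gam R r / 16.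
  by move=> iS iB; rewrite ee//; exact: good.
have e01 i : i \in S -> 0 <= e i <= 1 by move=> iS; rewrite ee//; apply: emp01.
have g0 := gam_gt0 R r; have g1 := gam_le1 R r.
have reg Z := step_regret rk Bb AS AK KS g e01 g0 g1 AD CD (Z := Z).
have enough := step_enough Bb e AS AK KS g0 g1 AD CD.
have dis := step_disjoint K e (gam R r) AS.
have wa := step_wrong_accept rk Bb AS AK KS g g0 g1 AD CD.
have wr := step_wrong_reject rk Bb AS AK KS g g0 g1 AD CD.
have gs i := step_gap_stop rk Bb AS AK KS g g0 g1 AD CD (i := i).
have ps := step_Psi_stop rk Bb AS AK KS g g0 g1 AD CD.
set Y := topset (K - #|A|) S e in reg enough dis wa wr gs ps *.
set acc := accepted Y S e (gam R r) in reg enough dis wa wr gs ps *.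
set rej := rejected Y S e (gam R r) in reg enough dis wa wr gs ps *.
set k' := (K - #|A :|: acc|)%N in reg enough dis wa wr gs ps *.
set S' := S :\: (acc :|: rej) in reg enough dis wa wr gs ps *.
set mn := minn k' (#|S'| - k') in reg gs ps *.
set stop := _ <= K%:R * eps / 2.
have b0 : 100 * ((r * b)%:R + b%:R) <= K%:R * eps.
  by apply: le_trans b_small; rewrite -natrD ler_wpM2l// ler_nat -mulSnr leq_mul2r ltnS rr orbT.
have rb0 : 0 <= (r * b)%:R :> R by [].
have bb0 : 0 <= b%:R :> R by [].
have Keps0 : 0 <= K%:R * eps by rewrite mulr_ge0// ltW.
have stopP : last || stop -> mn%:R * gam R r <= K%:R * eps / 2.
  case/orP => // /lastE ->; have mnK : (mn <= K)%N by rewrite geq_min leq_subr.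
  apply: (@le_trans _ _ (K%:R * (eps / 2))); last by rewrite mulrA.
  by apply: ler_pM => //; [rewrite ltW// gam_gt0|rewrite ler_nat].
have NBd i : ((if i \in S then N r else 0)%:R : R) <= Bd i.
  by case: ifP => [/NB//|_]; exact: Bd0.
case: ifPn => [/stopP mg|].
  have [] := reg (topset k' S' e) (topset_sub _ _ _) _.
    by rewrite card_topset; apply/minn_idPl.
  move=> cT regT; split => //=.
  (* The stopping rule leaves [9 / 16 * K * eps], and [b_small] bounds the error terms
     [4 * D + 6 * b] by [6 / 100 * K * eps]. *)
  by apply: le_trans regT _; rewrite mulrC mulrA -mulrA in mg *; lra.
rewrite negb_or -ltNge => /andP[lastF mg].
have mnk : (mn <= k')%N by rewrite geq_minl.
have small m : m%:R * gam R r <= K%:R * eps / 2 -> (m < mn)%N.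
  move=> Hm; rewrite -(ltr_nat R) -(ltr_pM2r g0); exact: le_lt_trans Hm mg.
have mnD : (r * b + b + b < mn)%N.
  apply: small; rewrite !natrD; have : ((r * b)%:R + b%:R + b%:R) * gam R r <= (r * b)%:R + b%:R + b%:R.
    by rewrite ler_piMr// !addr_ge0.
  lra.
have gapS' i : i \in S' -> i \notin B -> dl i <= 4 * gam R r.
  by move=> iS' iB; rewrite leNgt; apply/negP => /(gs i iS' iB); rewrite leqNgt mnD.
(* Otherwise all reliable undecided arms have gaps below [Ps], so the minimum side exceeds [t] by
   few errors only; and [t * Ps <= K * eps] gives [t * gam r <= K * eps / 4], so the stopping test
   would have succeeded. *)
have PsG : Ps <= 4 * gam R r.
  rewrite leNgt; apply/negP => PsG.
  have := ps (fun i iS' iB => le_lt_trans (gapS' i iS' iB) PsG).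
  rewrite leqNgt => /negP; apply; apply: small; rewrite !natrD.
  have : ((r * b)%:R + b%:R + b%:R) * gam R r <= (r * b)%:R + b%:R + b%:R.
    by rewrite ler_piMr// !addr_ge0.
  have := rk_tPsi rk; have : t%:R * (4 * gam R r) <= t%:R * Ps by rewrite ler_wpM2l// ltW.
  lra.
have epsG : eps <= 4 * gam R r.
  rewrite leNgt; apply/negP => epsG; move: mg; rewrite ltNge => /negP; apply.
  have : mn%:R * gam R r <= K%:R * (eps / 4).
    apply: ler_pM => //; first exact: ltW; last by lra.
    by rewrite ler_nat (leq_trans mnk)// leq_subr.
  lra.
have [] := nextP (A :|: acc) S' _ lastF.
  split => //.
  - have mn0 : (0 < mn)%N by exact: leq_ltn_trans (leq0n _) mnD.
    by split; rewrite -subn_gt0; apply: leq_trans mn0 _; [exact: mnk|exact: geq_minr].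
  - by rewrite mulSnr.
  - by rewrite mulSnr.
  - move=> i iS'; have [iB|iB] := boolP (i \in B); first exact: Bd_bad (lastN lastF).
    by apply: Bd_step => //; [exact: lastN|exact: gapS'|rewrite ge_max epsG PsG].
move=> cT regT rqT; split => // i.
by rewrite /maxn; case: ifP => _.
Qed.

Lemma small_phase_correct fuel r A S : (r + fuel = rmax)%N ->
  small_inv r A S -> small_good (small_phase fuel r A S).
Proof.
elim: fuel r A S => [|fuel IH] r A S rf inv /=; apply: small_body_correct => //.
- by rewrite -rf addn0.
- by move=> _; rewrite -rf addn0.
- by rewrite -rf leq_addr.
- by move=> _; rewrite -rf -addSnnS leq_addr.
- by move=> A' S' inv' _; apply: IH => //; rewrite addSnnS.
Qed.

End SmallAlgorithm.

(** * Halving tournaments *)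

Section Shrinking.
Variables (R : realType) (I : finType) (theta : I -> R).
Implicit Types (S C G Bs : {set I}).

Definition below C (a : R) : {set I} := [set i in C | theta i < a].

(* [C] may have lost a reliable arm [p] of [S] only in favour of arms that are,
   up to the few exceptions [Bs], at most [l] worse than [p]. *)
Definition covers S G (l : R) Bs m C : Prop :=
  forall p, p \in S -> p \notin G -> p \notin C ->
    below C (theta p - l) \subset Bs /\ #|C| = m.

Lemma covers_refl S G l Bs m : covers S G l Bs m S.
Proof. by move=> p ->. Qed.

(** If [p] is lost now, reliable survivors have estimates at least that of [p]. If [p] was lost
    before, a reliable survivor more than [2 * a] below [theta p - l] would force every arm of [C]
    outside [Bs] and [Bs'] to survive, and these outnumber the [m'] places. The exceptions therefore
    do not accumulate; only the latest [Bs'] remain. *)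
Lemma covers_topset S G l Bs m C (e : I -> R) (a : R) Bs' m' :
  covers S G l Bs m C -> 0 <= l -> 0 <= a ->
  (m' + #|Bs| + #|Bs'| < m)%N -> Bs' \subset G ->
  (forall i, i \in C -> i \notin Bs' -> `|e i - theta i| <= a) ->
  covers S G (l + 2 * a) Bs' m' (topset m' C e).
Proof.
move=> cov l0 a0 mlt BG he p pS pG pC'.
have hE i : i \in C -> i \notin Bs' -> theta i - a <= e i <= theta i + a.
  by move=> iC iB; have := he i iC iB; rewrite ler_norml; lra.
have TC i : i \in topset m' C e -> i \in C by exact: (fintype.subsetP (topset_sub _ _ _)).
have pB : p \notin Bs' by apply: contra pG; exact: (fintype.subsetP BG).
have [pC|pC] := boolP (p \in C); split.
- apply/fintype.subsetP => i; rewrite inE => /andP[iT]; apply: contraTT => iB.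
  have := hE i (TC _ iT) iB; have := hE p pC pB; have := topset_max iT pC pC'.
  rewrite -leNgt; lra.
- have [Cm|mC] := leqP #|C| m'; first by rewrite topset_id// pC in pC'.
  by rewrite card_topset; apply/minn_idPl/ltnW.
- have [low cm] := cov p pS pG pC.
  apply/fintype.subsetP => i; rewrite inE => /andP[iT]; apply: contraTT => iB.
  rewrite -leNgt leNgt; apply/negP => ilow.
  have /subset_leq_card : C :\: (Bs :|: Bs') \subset topset m' C e.
    apply/fintype.subsetP => q; rewrite !inE negb_or => /andP[/andP[qB qB'] qC].
    apply: contraT => qT; have := hE i (TC _ iT) iB; have := hE q qC qB'.
    have : theta p - l <= theta q.
      rewrite leNgt; apply: contra qB => qlow; apply: (fintype.subsetP low).
      by rewrite inE qC qlow.
    have := topset_max iT qC qT; lra.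
  rewrite card_topset => H.
  have h1 := leq_trans H (geq_minl _ _); have h2 := leq_card_setU Bs Bs'.
  have h3 := cardsID (Bs :|: Bs') C.
  have h4 : (#|C :&: (Bs :|: Bs')| <= #|Bs :|: Bs'|)%N.
    by apply: subset_leq_card; exact: finset.subsetIr.
  move: h1 h2.1 h3 h4 mlt; rewrite cm; clear; lia.
- have [_ cm] := cov p pS pG pC.
  by rewrite card_topset cm; apply/minn_idPl; move: mlt; clear; lia.
Qed.

End Shrinking.

(** * The threshold procedure with tournaments *)

Section LargeAlgorithm.
Variables (R : realType) (n K : nat) (eps : R) (Nb Ns : nat -> nat) (J s : nat).

Definition stage_size (j : nat) : nat := (K * 2 ^ (J - j))%N.

Fixpoint halving (f j : nat) (C : {set 'I_n}) (cont : {set 'I_n} -> prog R n) : prog R n :=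
  if f is f'.+1 then
    Ask (fun i => if i \in C then Ns j else 0%N) (fun X =>
      halving f' j.+1 (topset (stage_size j.+1) C (fun i => emp (X i) (Ns j))) cont)
  else cont C.

(* The threshold [V] is a running maximum: a rejection of a good top arm proves that
   the threshold used exceeds [thK], and then later, lower thresholds are ignored. *)
Definition large_body (last : bool) (r : nat) (next : R -> {set 'I_n} -> prog R n)
    (V : R) (S : {set 'I_n}) : prog R n :=
  Ask (fun i => if i \in S then Nb r else 0%N) (fun X =>
    let e := fun i => emp (X i) (Nb r) in
    halving J 0 (topset (stage_size 0) S e) (fun T =>
      Ask (fun i => if i \in T then Ns J else 0%N) (fun X' =>
        let f := fun i => emp (X' i) (Ns J) in
        let v := \big[Num.min/1]_(i in topset (K - s) T f) f i in
        let V' := Num.max V v in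
        if last || (#|S| <= stage_size 0)%N then Ret R T
        else next V' (T :|: [set i in S | (V' - gam R r / 2 <= e i)%R])))).

Fixpoint large_phase (fuel r : nat) : R -> {set 'I_n} -> prog R n :=
  if fuel is f.+1 then large_body false r (large_phase f r.+1)
  else large_body true r (fun _ _ => Ret R finset.set0).

Variables (theta dl : 'I_n -> R) (Top : {set 'I_n}) (thK Ps : R) (t : nat).
Hypothesis rk : ranked K eps theta dl Top thK Ps t.
Hypothesis eps0 : 0 < eps.
Variables (X : 'I_n -> nat -> R) (rmax : nat) (Bb : {set 'I_n}) (Bs : nat -> {set 'I_n}).
Variables (alpha : nat -> R) (G : {set 'I_n}) (beta : nat) (Bd : 'I_n -> R) (q : R).
Hypothesis rmax_eps : gam R rmax <= eps / 2.
Hypothesis eps_rmax : eps <= 4 * gam R rmax.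
Hypothesis J0 : (1 < J)%N.
Hypothesis good_base : forall i r, i \notin Bb -> (r <= rmax)%N ->
  `|emp (X i) (Nb r) - theta i| <= gam R r / 16.
Hypothesis good_stage : forall i j, i \notin Bs j -> (j <= J)%N ->
  `|emp (X i) (Ns j) - theta i| <= alpha j.
Hypothesis alpha0 : forall j, 0 <= alpha j.
Hypothesis alpha_sum : 2 * \sum_(j < J) alpha j <= eps / 16.
Hypothesis alphaJ : alpha J <= eps / 64.
Hypothesis BbG : Bb \subset G.
Hypothesis BsG : forall j, (j <= J)%N -> Bs j \subset G.
Hypothesis cBb : (8 * #|Bb| <= stage_size 0)%N.
Hypothesis cBs : forall j, (j <= J)%N -> (16 * #|Bs j| <= stage_size j)%N.
Hypothesis cBs_last : forall j, (j <= J)%N -> (J <= j.+1)%N -> (#|Bs j| <= beta)%N.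
Hypothesis cTopG : (#|Top :&: G| <= beta)%N.
Hypothesis beta_s : (2 * beta <= s)%N.
Hypothesis s_K : (s < K)%N.
Hypothesis s_eps : 100 * s%:R <= K%:R * eps.
Hypothesis Bd0 : forall i, 0 <= Bd i.
Hypothesis Bd_bad : forall i r, i \in Bb -> (r <= rmax)%N -> (Nb r)%:R <= Bd i.
Hypothesis Bd_top : forall i r, i \in Top -> (r <= rmax)%N -> (Nb r)%:R <= Bd i.
Hypothesis Bd_step : forall i r, (r < rmax)%N ->
  dl i <= 4 * gam R r -> Num.max eps Ps <= 4 * gam R r -> (Nb r.+1)%:R <= Bd i.
Hypothesis q_phase : forall r, (r <= rmax)%N ->
  (stage_size 0)%:R * (Nb r)%:R + \sum_(j < J.+1) (stage_size j)%:R * (Ns j)%:R <= q.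

(** [Bd] is attached to the arms, whereas the participants of a tournament vary with the rewards.
    Their pulls are charged to [Q], of which only the total is bounded. *)
Definition large_good (c : R) (p : prog R n) : Prop :=
  [/\ #|run p X| = K,
      \sum_(i in Top) theta i - \sum_(i in run p X) theta i <= K%:R * eps &
      exists Q : 'I_n -> R, [/\ forall i, 0 <= Q i, \sum_i Q i <= c &
        forall i, (demand p X i)%:R <= Bd i + Q i] ].

Lemma large_good_ask (E C : {set 'I_n}) N m k c :
  (#|E| <= m)%N -> (forall i, i \in C -> i \notin E -> N%:R <= Bd i) ->
  let req := fun i => if i \in C then N else 0%N in
  large_good c (k (visible req X)) ->
  large_good (m%:R * N%:R + c) (Ask req k).
Proof.
move=> Em H req [cT regT [Q [Q0 Qs Qr]]]; split => //=.
exists (fun i => (if i \in E then N%:R else 0) + Q i); split.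
- by move=> i; rewrite addr_ge0//; case: ifP.
- rewrite big_split /= lerD// -big_mkcond /= sumr_const -[X in X <= _]mulr_natl.
  by rewrite ler_wpM2r// ler_nat.
- move=> i; rewrite /maxn; case: ifP => _.
    apply: le_trans (Qr i) _; rewrite lerD2l lerDr; by case: ifP.
  rewrite /req; have q0 := Q0 i; have b0 := Bd0 i.
  case: ifPn => [iC|_]; case: ifPn => [iE|iE].
  + lra.
  + have := H i iC iE; lra.
  + have : 0 <= N%:R :> R by []. lra.
  + rewrite mulr0n; lra.
Qed.

Lemma stage_size0 : (4 * K <= stage_size 0)%N.
Proof.
rewrite /stage_size subn0 mulnC leq_mul2l; apply/orP; right.
by rewrite (_ : 4 = 2 ^ 2)%N// leq_exp2l.
Qed.

Lemma stage_sizeS j : (j < J)%N -> stage_size j = (2 * stage_size j.+1)%N.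
Proof.
by move=> jJ; rewrite /stage_size mulnCA -expnS subnSK.
Qed.

(** The unreliable arms of the selection that produced the field of stage [j]; the field of stage 0
    comes from the base estimates. *)
Definition prev_bad (j : nat) : {set 'I_n} := if j is j'.+1 then Bs j' else Bb.

Lemma prev_bad_card j : (j < J)%N -> (4 * #|prev_bad j| <= stage_size j.+1)%N.
Proof.
case: j => [|j] jJ /=.
  have arith (a b c : nat) : (8 * a <= b -> b = 2 * c -> 4 * a <= c)%N by clear; lia.
  exact: arith cBb (stage_sizeS jJ).
have arith (a b c e : nat) :
    (b = 2 * c -> c = 2 * e -> 16 * a <= b -> 4 * a <= e)%N by clear; lia.
exact: arith (stage_sizeS (ltnW jJ)) (stage_sizeS jJ) (cBs (ltnW (ltnW jJ))).
Qed.

Definition halving_inv (S : {set 'I_n}) (l : R) (j : nat) (C : {set 'I_n}) : Prop :=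
  [/\ C \subset S, (K <= #|C| <= stage_size j)%N &
      covers theta S G (l + 2 * \sum_(i < j) alpha i) (prev_bad j) (stage_size j) C].

Lemma halving_good S l c cont f j C : 0 <= l -> (j + f = J)%N -> halving_inv S l j C ->
  (forall T, halving_inv S l J T -> large_good c (cont T)) ->
  large_good (\sum_(j <= i < J) (stage_size i)%:R * (Ns i)%:R + c) (halving f j C cont).
Proof.
move=> l0; elim: f j C => [|f IH] j C jf inv contP.
  rewrite addn0 in jf; subst j; rewrite big_geq// add0r; exact: contP.
have jJ : (j < J)%N by rewrite -jf -addSnnS leq_addr.
case: inv => CS /andP[KC Cj] cov.
rewrite big_ltn// -addrA /=; apply: (large_good_ask (E := C) Cj).
  by move=> i ->.
apply: IH => //; first by rewrite addSnnS.
set e := fun i => emp _ _.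
have size1 : (K <= stage_size j.+1)%N by rewrite /stage_size leq_pmulr// expn_gt0.
split.
- exact: fintype.subset_trans (topset_sub _ _ _) CS.
- by rewrite card_topset geq_minl leq_min size1 KC.
- rewrite big_ord_recr /= mulrDr addrA.
  apply: (covers_topset cov) => //.
  + by rewrite addr_ge0// mulr_ge0// sumr_ge0.
  + have size0 : (0 < stage_size j.+1)%N by rewrite (leq_trans _ size1)// (leq_trans _ s_K).
    have arith (a d p b : nat) : (a = 2 * d -> 4 * p <= d -> 16 * b <= a -> 0 < d ->
      d + p + b < a)%N by clear; lia.
    exact: arith (stage_sizeS jJ) (prev_bad_card jJ) (cBs (ltnW jJ)) size0.
  + exact/BsG/ltnW.
  + move=> i iC iB; rewrite /e emp_visible ?iC//; apply: good_stage => //; exact: ltnW.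
Qed.

(** The second clause limits the damage of a threshold above [thK], and the third says that reliable
    top arms disappear only below the threshold. [E] holds the arms whose base estimates are charged
    to the phase itself. *)
Definition large_inv (r : nat) (V : R) (S : {set 'I_n}) : Prop :=
  [/\ (K <= #|S|)%N,
      (K <= #|[set i | (V - eps / 64 <= theta i)%R]| + (s + beta))%N,
      (forall i, i \in Top -> i \notin G -> V - eps / 64 <= theta i -> i \in S) &
      exists E : {set 'I_n}, (#|E| <= stage_size 0)%N /\
        forall i, i \in S -> i \notin E -> (Nb r)%:R <= Bd i].

Lemma bot_theta i : i \notin Top -> theta i <= thK.
Proof. by move=> iT; have := rk_gap_bot rk iT; have := rk_gap rk i; lra. Qed.

(** A threshold at most [thK + eps / 64] loses no reliable top arm. Above that, the arms counted by
    the second clause of [large_inv] all have means above [thK], so they are top arms and all but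
    [s + beta] of the top arms are among them. *)
Lemma missing_tops r V S : large_inv r V S ->
  (#|Top :\: (S :\: G)| <= s + beta + beta)%N.
Proof.
case=> _ V1 V2 _; have [VK|VK] := leP V (thK + eps / 64).
  apply: (@leq_trans #|Top :&: G|); last by apply: leq_trans cTopG _; rewrite leq_addl.
  apply: subset_leq_card; apply/fintype.subsetP => i.
  rewrite !inE negb_and negbK => /andP[+ iT]; rewrite iT /=.
  have [//|iG /=] := boolP (i \in G); rewrite V2//; have := rk_top rk iT; lra.
have c1 : (#|Top :\: [set i | (V - eps / 64 <= theta i)%R]| <= s + beta)%N.
  have sub : [set i | (V - eps / 64 <= theta i)%R] \subset Top.
    apply/fintype.subsetP => i; rewrite inE => Vi; apply: contraT => /bot_theta; lra.
  have := cardsDS sub; rewrite (rk_card rk) => ->; rewrite leq_subLR; exact: V1.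
apply: (card_le_cover _ c1 cTopG); apply/fintype.subsetP => i.
rewrite !inE negb_and negbK => /andP[+ iT]; rewrite iT /= andbT.
have [//|iG] := boolP (i \in G); first by rewrite orbT.
by rewrite orbF /=; apply: contra => Vi; rewrite V2.
Qed.

Lemma large_regret r V S (l : R) (T : {set 'I_n}) : large_inv r V S -> 0 <= l <= eps / 4 -> T \subset S ->
  #|T| = K -> covers theta S G l (Bs J.-1) K T ->
  \sum_(i in Top) theta i - \sum_(i in T) theta i <= K%:R * eps.
Proof.
move=> inv /andP[l0 l4] TS cT cov.
have mt := missing_tops inv; have se := s_eps; have s0 : 0 <= s%:R :> R by [].
have cTT : #|Top| = #|T| by rewrite (rk_card rk) cT.
have th i : 0 <= theta i <= 1 := rk_theta rk i.
have K0 : 0 <= K%:R * eps by rewrite mulr_ge0// ltW.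
have bs : (beta%:R * 2 <= s%:R :> R) by rewrite -natrM ler_nat mulnC.
have b0 : 0 <= beta%:R :> R by [].
have mtR : #|Top :\: (S :\: G)|%:R <= s%:R + beta%:R + beta%:R :> R.
  by rewrite -!natrD ler_nat.
have [sub|] := boolP (Top :&: (S :\: G) \subset T).
  rewrite (sum_setD theta 0 cTT).
  have : \sum_(i in Top :\: T) (theta i - 0) <=
      0 * #|Top :\: T|%:R + #|(Top :\: T) :&: ~: (S :\: G)|%:R.
    apply: sum_exceptions => // i; last by rewrite subr0; case/andP: (th i).
    rewrite !finset.in_setD => /andP[iT iTop]; rewrite finset.in_setC negbK => iSG.
    by have := fintype.subsetP sub i; rewrite finset.in_setI iTop iSG (negbTE iT) => /(_ isT).
  have : 0 <= \sum_(i in T :\: Top) (theta i - 0).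
    by apply: sumr_ge0 => i _; rewrite subr0; case/andP: (th i).
  have : #|(Top :\: T) :&: ~: (S :\: G)|%:R <= #|Top :\: (S :\: G)|%:R :> R.
    rewrite ler_nat; apply: subset_leq_card; apply/fintype.subsetP => i; rewrite !inE.
    by case: (i \in Top); rewrite ?andbF//= => /andP[_ ->].
  rewrite mul0r; lra.
case/subsetPn => p0 p0Z p0T.
have p0P : p0 \in (Top :&: (S :\: G)) :\: T by rewrite finset.in_setD p0T.
(* Centring at the best surviving reliable top arm [p] missing from [T] makes the missed arms cost
   nothing but exceptions, while [covers] puts all but [beta] arms of [T] at most [l] below it. *)
case: (@arg_maxP _ _ _ p0 (fun i => i \in (Top :&: (S :\: G)) :\: T) theta p0P).
move=> p; rewrite !inE => /and4P[pT pTop pG pS] pmax.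
have [low _] := cov p pS pG pT.
have clow : #|below theta T (theta p - l)|%:R <= beta%:R :> R.
  rewrite ler_nat; apply: leq_trans (subset_leq_card low) _.
  apply: cBs_last; first exact: leq_pred.
  by rewrite prednK// ltnW.
rewrite (sum_setD theta (theta p) cTT).
have h1 : \sum_(i in Top :\: T) (theta i - theta p) <=
    0 * #|Top :\: T|%:R + #|(Top :\: T) :&: ~: (S :\: G)|%:R.
  apply: sum_exceptions => // i; last by have := th i; have := th p; lra.
  move=> iTT; rewrite finset.in_setC negbK => iSG; rewrite subr_le0; apply: (pmax i).
  by move: iTT iSG; rewrite !inE => /andP[-> ->] ->.
have h2 : \sum_(i in T :\: Top) (- (theta i - theta p)) <=
    l * #|T :\: Top|%:R + #|(T :\: Top) :&: below theta T (theta p - l)|%:R.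
  apply: sum_exceptions => // i; last by have := th i; have := th p; lra.
  rewrite !inE => /andP[iTop ->] /=; rewrite -leNgt; lra.
rewrite sumrN in h2.
have h3 : #|(Top :\: T) :&: ~: (S :\: G)|%:R <= #|Top :\: (S :\: G)|%:R :> R.
  rewrite ler_nat; apply: subset_leq_card; apply/fintype.subsetP => i; rewrite !inE.
  by case: (i \in Top); rewrite ?andbF//= => /andP[_ ->].
have h4 : #|(T :\: Top) :&: below theta T (theta p - l)|%:R <= beta%:R :> R.
  apply: le_trans clow; rewrite ler_nat; apply: subset_leq_card; exact: finset.subsetIr.
have h5 : l * #|T :\: Top|%:R <= K%:R * eps / 4.
  rewrite mulrC -mulrA; apply: ler_pM => //.
  by rewrite ler_nat -cT; apply: subset_leq_card; exact: finset.subsetDl.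
rewrite mul0r in h1; lra.
Qed.

Lemma large_body_correct (last : bool) r next V S c : (r <= rmax)%N -> (last -> r = rmax) ->
  (~~ last -> (r < rmax)%N) -> 0 <= c ->
  (forall V' S', large_inv r.+1 V' S' -> ~~ last -> large_good c (next V' S')) ->
  large_inv r V S -> large_good (q + c) (large_body last r next V S).
Proof.
move=> rr lastE lastN c0 nextP inv; case: (inv) => KS V1 V2 [E [cE EP]].
have g0 := gam_gt0 R r; have g1 := gam_le1 R r.
have grm : gam R rmax <= gam R r.
  by rewrite /gam ler_wiXn2l ?invr_ge0// invf_le1// ler1n.
suff H : large_good ((stage_size 0)%:R * (Nb r)%:R +
   (\sum_(0 <= i < J) (stage_size i)%:R * (Ns i)%:R + ((stage_size J)%:R * (Ns J)%:R + c)))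
   (large_body last r next V S).
  case: H => cT regT [Q [Q0 Qs Qr]]; split => //; exists Q; split => //.
  apply: le_trans Qs _; have := q_phase rr.
  by rewrite big_ord_recr /= -[\sum_(i < J) _](big_mkord xpredT (fun i => (stage_size i)%:R * (Ns i)%:R)); lra.
apply: (large_good_ask cE EP).
set e := fun i => emp _ _.
have ee i : i \in S -> e i = emp (X i) (Nb r).
  by move=> iS; rewrite /e emp_visible// iS.
have hE i : i \in S -> i \notin Bb -> theta i - gam R r / 16 <= e i <= theta i + gam R r / 16.
  by move=> iS iB; have := good_base iB rr; rewrite -ee// ler_norml; lra.
(* A set that already fits into the tournament passes the base selection unchanged and suffers no
   drift; this is what permits stopping early, at any accuracy. *)
pose l : R := if (#|S| <= stage_size 0)%N then 0 else gam R r / 8.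
have l0 : 0 <= l by rewrite /l; case: ifP => // _; rewrite divr_ge0// ltW.
have lg : l <= gam R r / 8 by rewrite /l; case: ifP => // _; rewrite divr_ge0// ltW.
have KK : (K <= stage_size 0)%N by apply: leq_trans stage_size0; rewrite leq_pmull.
have asum : 0 <= \sum_(j < J) alpha j by apply: sumr_ge0.
apply: (halving_good l0 (add0n J) (S := S)).
  split; [exact: topset_sub|by rewrite card_topset geq_minl leq_min KK KS|].
  rewrite big_ord0 mulr0 addr0 /l; case: ifPn => [small|]; first by rewrite topset_id//; exact: covers_refl.
  rewrite -ltnNge => big.
  rewrite (_ : gam R r / 8 = 0 + 2 * (gam R r / 16)); last by lra.
  (* [covers_refl] holds for every size; this one is picked to meet the strict inequality. *)
  apply: (@covers_topset _ _ _ _ _ _ finset.set0 (stage_size 0 + #|Bb|).+1) => //.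
  - exact: covers_refl.
  - by rewrite divr_ge0// ltW.
  - by rewrite cards0 addn0.
  - by move=> i iS iB; rewrite ee//; exact: good_base.
move=> T [TS /andP[KT TK] cov].
have sJ : stage_size J = K by rewrite /stage_size subnn muln1.
have pJ : prev_bad J = Bs J.-1 by rewrite /prev_bad; case: (J) J0.
rewrite sJ pJ in cov TK.
have cT : #|T| = K by apply/eqP; rewrite eqn_leq TK.
set ll := l + _ in cov.
have ll0 : 0 <= ll by rewrite addr_ge0// mulr_ge0.
have llg : ll <= gam R r / 8 + eps / 16 by rewrite lerD.
apply: (large_good_ask (E := T)); [by rewrite sJ TK|by move=> i ->|].
set f := fun i => emp _ _; cbv zeta.
set Y := topset (K - s) T f; set v := \big[_/_]_(_ in _) _; set V' := Num.max V v.
set S' := T :|: _.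
have hf i : i \in T -> i \notin Bs J -> theta i - eps / 64 <= f i <= theta i + eps / 64.
  move=> iT iB; have := good_stage iB (leqnn J); rewrite /f emp_visible ?iT//.
  by rewrite ler_norml; have := alphaJ; lra.
case: ifPn => [stop|].
  split => //=; last first.
    exists (fun=> 0); split => // [|i]; first by rewrite big1.
    by rewrite addr0.
  apply: (large_regret inv _ TS cT cov); rewrite ll0 /=.
  rewrite /ll /l; have := alpha_sum; have := rmax_eps; have e0 := eps0.
  case/orP: stop => [/lastE rE|->]; last by lra.
  by rewrite rE; case: ifP => _; lra.
rewrite negb_or -ltnNge => /andP[lastF bigS].
apply: (nextP _ _ _ lastF).
have rlt := lastN lastF.
have beJ : (#|Bs J| <= beta)%N by apply: cBs_last.
have vY i : i \in Y -> v <= f i.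
  by move=> iY; rewrite /v; apply: bigmin_le_cond.
have VV' : V <= V' by rewrite le_max lexx.
have vV' : v <= V' by rewrite le_max lexx orbT.
have cY : #|Y| = (K - s)%N by rewrite card_topset cT; apply/minn_idPl; exact: leq_subr.
have TS' : T \subset S' by exact: finset.subsetUl.
(* The terms are the drift of base selection and tournament, then the error of the final estimates.
   If [V] is already above [thK], the running maximum gives the bound at once. *)
have V'low : thK - gam R r / 8 - eps / 16 - eps / 64 <= V'.
  have [VK|VK] := leP V (thK + eps / 64); last first.
    by apply: le_trans VV'; have := eps0; lra.
  apply: le_trans vV'.
  (* The lower bound must also hold for the default value 1 of the minimum. *)
  have thK1 : thK - gam R r / 8 - eps / 16 - eps / 64 <= 1.
    have [p pT] : exists p, p \in Top.
      by apply/set0Pn; rewrite -card_gt0 (rk_card rk) (leq_ltn_trans _ s_K).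
    by have := rk_top rk pT; have := rk_theta rk p; have := eps0; lra.
  apply/bigmin_geP; split => // i; apply: topset_ge.
  set a := thK - gam R r / 8 - eps / 16.
  (* Either all reliable top arms are in [T], leaving at most [beta] places for others, or a missing
     one certifies through [covers] that [T] contains few low arms. Together with the unreliable
     arms of the last stage this makes at most [2 * beta <= s] spoiled values, which is why the
     threshold skips the [s] lowest. *)
  have lowc : (#|below theta T a| <= beta)%N.
    have [sub|] := boolP (Top :\: G \subset T).
      have c1 : (#|T :\: (Top :\: G)| <= beta)%N.
        rewrite (cardsDS sub) cT; have := cardsID G Top; rewrite (rk_card rk).
        by move: cTopG; clear; lia.
      apply: leq_trans c1; apply: subset_leq_card; apply/fintype.subsetP => j.
      rewrite !inE => /andP[jT ja]; rewrite jT andbT negb_and negbK orbC.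
      apply: contraTT ja; rewrite negb_or negbK -leNgt => /andP[jTop _].
      by have := rk_top rk jTop; have := eps0; rewrite /a; lra.
    case/subsetPn => p; rewrite inE => /andP[pG pTop] pT.
    have pS : p \in S by apply: V2 => //; have := rk_top rk pTop; lra.
    have [low _] := cov p pS pG pT.
    have : (#|below theta T (theta p - ll)| <= beta)%N.
      apply: leq_trans (subset_leq_card low) _; apply: cBs_last; first exact: leq_pred.
      by rewrite prednK// ltnW.
    apply: leq_trans; apply: subset_leq_card; apply/fintype.subsetP => j.
    rewrite !inE => /andP[-> ja] /=; have := rk_top rk pTop; move: ja; rewrite /a; lra.
  have : (#|T :\: (below theta T a :|: Bs J)| <= #|[set j in T | (a - eps / 64 <= f j)%R]|)%N.
    apply: subset_leq_card; apply/fintype.subsetP => j.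
    rewrite finset.in_setD finset.in_setU negb_or => /andP[/andP[jb jB] jT].
    have := hf j jT jB; rewrite inE jT /=; move: jb; rewrite inE jT /= -leNgt; lra.
  apply: leq_trans; rewrite -cT.
  have h1 := cardsID (below theta T a :|: Bs J) T.
  have h2 := (leq_card_setU (below theta T a) (Bs J)).1.
  have h3 : (#|T :&: (below theta T a :|: Bs J)| <= #|below theta T a :|: Bs J|)%N.
    by apply: subset_leq_card; exact: finset.subsetIr.
  have arith (k x y u w z b' m : nat) : (x + y = k -> x <= u -> u <= w + z -> w <= b' ->
    z <= b' -> 2 * b' <= m -> k - m <= y)%N by clear; lia.
  exact: arith h1 h3 h2 lowc beJ beta_s.
have cS' : (K <= #|S'|)%N by rewrite -cT; exact: subset_leq_card.
split => //.
- rewrite /V'; case: (leP V v) => // _.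
  have : (#|Y :\: Bs J| <= #|[set i | (v - eps / 64 <= theta i)%R]|)%N.
    apply: subset_leq_card; apply/fintype.subsetP => i; rewrite finset.in_setD inE => /andP[iB iY].
    have iT := fintype.subsetP (topset_sub _ _ _) _ iY.
    have := hf i iT iB; have := vY i iY; lra.
  have h1 := cardsID (Bs J) Y; rewrite cY in h1.
  have h2 : (#|Y :&: Bs J| <= #|Bs J|)%N by apply: subset_leq_card; exact: finset.subsetIr.
  have arith (k x y u b' m z : nat) : (x + y = k - m -> x <= u -> u <= b' -> y <= z ->
    k <= z + (m + b'))%N by clear; lia.
  exact: arith h1 h2 beJ.
- move=> i iTop iG Vi; have iS : i \in S by apply: V2 => //; have := VV'; lra.
  have iB : i \notin Bb by apply: contra iG; exact: (fintype.subsetP BbG).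
  rewrite finset.in_setU inE iS /=; apply/orP; right.
  have := hE i iS iB; have := eps_rmax; lra.
- have [small|bigS'] := leqP #|S'| (stage_size 0).
    by exists S'; split => // i ->.
  have dlS' i : i \in S' -> i \notin T -> i \notin Bb -> i \notin Top -> dl i <= 4 * gam R r.
    rewrite finset.in_setU => /orP[->//|]; rewrite inE => /andP[iS Vi] _ iB iTop.
    rewrite (rk_gap_bot rk iTop); have := hE i iS iB; have := eps_rmax; lra.
  have PsG : Ps <= 4 * gam R r.
    (* Otherwise [S'] consists of [T], [Top], unreliable arms and at most [t < K] others, so it
       would fit into the tournament. *)
    rewrite leNgt; apply/negP => PsG; move: bigS'; rewrite ltnNge => /negP; apply.
    have : (#|S'| <= (K + #|Bb|) + (K + t))%N.
      apply: (@card_le_cover _ _ (T :|: Bb) (Top :|: [set i in ~: Top | (dl i < Ps)%R])).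
      - apply/fintype.subsetP => i iS'; rewrite !finset.in_setU inE finset.in_setC.
        have [//|iT] := boolP (i \in T); have [//|iB] := boolP (i \in Bb).
        have [//|iTop] := boolP (i \in Top).
        by rewrite (le_lt_trans (dlS' i iS' iT iB iTop) PsG).
      - by rewrite -cT; exact: (leq_card_setU T Bb).1.
      - rewrite -(rk_card rk); apply: leq_trans (leq_card_setU _ _).1 _.
        by rewrite leq_add2l; exact: rk_count_bot rk.
    have arith (a b m k u : nat) : (u < k -> 4 * k <= m -> 8 * b <= m ->
      a <= (k + b) + (k + u) -> a <= m)%N by clear; lia.
    exact: arith (rk_tK rk) stage_size0 cBb.
  exists T; split; first by rewrite cT.
  move=> i iS' iT; have [iB|iB] := boolP (i \in Bb); first exact: Bd_bad.
  have [iTop|iTop] := boolP (i \in Top); first exact: Bd_top.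
  apply: Bd_step => //; first exact: dlS'.
  by rewrite ge_max PsG andbT (le_trans eps_rmax)// ler_wpM2l.
Qed.

Lemma large_phase_correct fuel r V S : 0 <= q -> (r + fuel = rmax)%N ->
  large_inv r V S -> large_good (fuel.+1%:R * q) (large_phase fuel r V S).
Proof.
move=> q0; elim: fuel r V S => [|fuel IH] r V S rf inv.
  rewrite mul1r -[q]addr0; apply: large_body_correct inv => //.
  - by rewrite -rf addn0.
  - by move=> _; rewrite -rf addn0.
rewrite -[fuel.+2%:R]natr1 mulrDl mul1r addrC; apply: large_body_correct inv => //.
- by rewrite -rf leq_addr.
- by move=> _; rewrite -rf -addSnnS leq_addr.
- by rewrite mulr_ge0.
- by move=> V' S' inv' _; apply: IH => //; rewrite addSnnS.
Qed.

End LargeAlgorithm.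

(** * Choice of the parameters *)

Section MinInvSq.
Variable R : realType.

Lemma min_inv_sq_ge (D Q a : R) : 0 <= D <= a -> 0 < Q <= a -> a ^- 2 <= min_inv_sq D Q.
Proof.
move=> /andP[D0 Da] /andP[Q0 Qa].
have a0 : 0 < a := lt_le_trans Q0 Qa.
have inv (x : R) : 0 < x -> x <= a -> a ^- 2 <= x ^- 2.
  move=> x0 xa; rewrite lef_pV2 ?posrE ?exprn_gt0//.
  by rewrite lerXn2r ?nnegrE// ltW.
rewrite /min_inv_sq; case: eqP => [_|/eqP D1]; first exact: inv.
by rewrite le_min !inv// lt_def D1.
Qed.

End MinInvSq.

Section Tuning.
Variables (R : realType) (eps delta : R).

Definition log_factor : R := ln (1 / eps) + ln (1 / delta).
(** With radius [gam r / 16] the Chernoff exponent is [gam r ^+ 2 * N / 2 ^+ 11], and with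
    [eps / 256] it is [eps ^+ 2 * N / 2 ^+ 19]; the factor 21 turns either into the failure
    probability [(eps * delta) ^+ 21]. *)
Definition base_const : R := 2 ^+ 11 * 21.
Definition stage_const : R := 2 ^+ 19 * 21.
Definition base_pulls (r : nat) : nat := (Num.truncn (base_const * log_factor * 4 ^+ r)).+1.
Definition stage_pulls (j : nat) : nat :=
  (Num.truncn (stage_const * log_factor * eps ^- 2 * (3 / 2) ^+ j)).+1.
Definition last_phase : nat := (trunc_log 2 (Num.truncn (2 / eps))).+1.
(* The radii are summable, which bounds the drift over a tournament by [eps / 16],
   whatever its length; [(7 / 8) ^ 2 * (3 / 2) > 1] makes the failure
   probability of a stage decrease geometrically, and the total cost of a tournament
   converges because [3 / 2 < 2]. *)
Definition stage_radius (j : nat) : R := eps / 256 * (7 / 8) ^+ j.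

Hypotheses (eps0 : 0 < eps) (eps1 : eps <= 1 / 2).
Hypotheses (delta0 : 0 < delta) (delta1 : delta <= 1 / 2).

Lemma expR_log (m : nat) : expR (- (m%:R * log_factor)) = (eps * delta) ^+ m.
Proof.
rewrite -mulrN mulrC expRM_natr /log_factor !div1r !lnV ?posrE//.
by rewrite -opprD opprK expRD !lnK ?posrE.
Qed.

Lemma log_factor_ge1 : 1 <= log_factor.
Proof.
have e0 := eps0; have e1 := eps1; have d0 := delta0; have d1 := delta1.
have h (x : R) : 0 < x -> x <= 1 / 2 -> 1 / 2 <= ln (1 / x).
  move=> x0 x1; rewrite [1 / x]div1r lnV ?posrE//.
  have := expR_ge1Dx (ln x); rewrite lnK ?posrE//; lra.
have := h _ eps0 eps1; have := h _ delta0 delta1; rewrite /log_factor; lra.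
Qed.

Lemma gam_sqr r : gam R r ^+ 2 * 4 ^+ r = 1.
Proof.
rewrite /gam -exprM mulnC exprM -exprMn (_ : 2^-1 ^+ 2 * 4 = 1) ?expr1n//.
by field.
Qed.

Lemma base_const_gt0 : 0 < base_const.
Proof. by rewrite /base_const mulr_gt0// exprn_gt0. Qed.

Lemma stage_const_gt0 : 0 < stage_const.
Proof. by rewrite /stage_const mulr_gt0// exprn_gt0. Qed.

Lemma base_const_ge1 : 1 <= base_const.
Proof. by rewrite /base_const mulr_ege1 ?exprn_ege1 ?ler1n. Qed.

Lemma stage_const_ge1 : 1 <= stage_const.
Proof. by rewrite /stage_const mulr_ege1 ?exprn_ege1 ?ler1n. Qed.

Lemma truncnS_le (x : R) : 1 <= x -> (Num.truncn x).+1%:R <= 2 * x.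
Proof.
move=> x1; rewrite -natr1; have /truncn_itv/andP[] : 0 <= x by lra. lra.
Qed.

Lemma base_pulls_le r : (base_pulls r)%:R <= 2 * (base_const * log_factor * 4 ^+ r).
Proof.
have b1 := base_const_ge1; have l1 := log_factor_ge1.
apply: truncnS_le; apply: mulr_ege1; last by rewrite exprn_ege1 ?ler1n.
exact: mulr_ege1.
Qed.

Lemma eps_inv_ge1 : 1 <= eps ^- 2.
Proof.
have e0 := eps0; have e1 := eps1; rewrite invf_ge1 ?exprn_gt0// expr_le1//; lra.
Qed.

Lemma stage_pulls_le j :
  (stage_pulls j)%:R <= 2 * (stage_const * log_factor * eps ^- 2 * (3 / 2) ^+ j).
Proof.
have s1 := stage_const_ge1; have l1 := log_factor_ge1; have e1 := eps_inv_ge1.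
have h1 : 1 <= 3 / 2 :> R by lra.
apply: truncnS_le; apply: mulr_ege1; last exact: exprn_ege1.
by apply: mulr_ege1 => //; exact: mulr_ege1.
Qed.

Lemma last_phaseP : 2 / eps <= 2 ^+ last_phase <= 4 / eps.
Proof.
have e0 := eps0; have e1 := eps1.
have h1 : 1 <= 2 / eps by rewrite ler_pdivlMr// mul1r; lra.
have t0 : (0 < Num.truncn (2 / eps))%N by rewrite truncn_gt0.
rewrite /last_phase -natrX; apply/andP; split.
  apply: le_trans (ltW (truncnS_gt _)) _; rewrite ler_nat.
  exact: trunc_log_ltn.
rewrite expnS natrM (_ : 4 / eps = 2 * (2 / eps)); last by field; exact: lt0r_neq0.
rewrite ler_wpM2l//; apply: (@le_trans _ _ (Num.truncn (2 / eps))%:R).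
  by rewrite ler_nat; exact: trunc_logP.
by rewrite truncn_le; lra.
Qed.

Lemma gamE r : gam R r = (2 ^+ r)^-1.
Proof. by rewrite /gam exprVn. Qed.

Lemma gam_last : gam R last_phase <= eps / 2.
Proof.
have /andP[h _] := last_phaseP; rewrite gamE -[eps / 2]invrK lef_pV2 ?posrE ?exprn_gt0//.
  by rewrite invf_div.
by rewrite invr_gt0 divr_gt0.
Qed.

Lemma last_gam : eps <= 4 * gam R last_phase.
Proof.
have /andP[_ h] := last_phaseP; rewrite gamE ler_pdivlMr ?exprn_gt0//.
by rewrite mulrC -ler_pdivlMr.
Qed.

Lemma last_phase_le : last_phase.+1%:R <= 4 / eps.
Proof.
have /andP[_ h] := last_phaseP; apply: le_trans h; rewrite -natrX ler_nat.
exact: ltn_expl.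
Qed.

Lemma base_pulls_last r : (r <= last_phase)%N ->
  (base_pulls r)%:R <= 32 * (base_const * log_factor * eps ^- 2).
Proof.
move=> rl; apply: le_trans (base_pulls_le r) _.
have L0 : 0 <= base_const * log_factor.
  by rewrite mulr_ge0 ?(ltW base_const_gt0)// (le_trans _ log_factor_ge1).
have : 4 ^+ r <= 16 * eps ^- 2 :> R.
  apply: (@le_trans _ _ (4 ^+ last_phase)); first by rewrite ler_weXn2l// ler1n.
  have /andP[_ h] := last_phaseP.
  have -> : 4 = 2 ^+ 2 :> R by rewrite -natrX.
  rewrite -exprM mulnC exprM (_ : 16 * _ = (4 / eps) ^+ 2); last by field; exact: lt0r_neq0.
  by rewrite lerXn2r// nnegrE; [exact: exprn_ge0|apply: divr_ge0 => //; exact: ltW].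
move=> /(ler_wpM2l L0); lra.
Qed.

Lemma tail_base r :
  2 * expR (- ((gam R r / 16) ^+ 2 * (base_pulls r)%:R / 8)) <= 2 * (eps * delta) ^+ 21.
Proof.
rewrite ler_wpM2l// -expR_log ler_expR lerN2.
have := ltW (truncnS_gt (base_const * log_factor * 4 ^+ r)).
have g2 : 0 <= gam R r ^+ 2 by exact: sqr_ge0.
move=> /(ler_wpM2l g2); rewrite mulrCA gam_sqr mulr1 /base_const => h.
have -> : (gam R r / 16) ^+ 2 * (base_pulls r)%:R / 8 =
   (gam R r ^+ 2 * (base_pulls r)%:R) / 2 ^+ 11 by field.
by rewrite ler_pdivlMr ?exprn_gt0// [X in X <= _]mulrC [X in X <= _]mulrA.
Qed.

(** Bernoulli's inequality, as [147 / 128 >= 8 / 7]. Since [21 * (1 + j / 7) = 21 + 3 * j], stage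
    [j] gains an extra factor [(eps * delta) ^+ (3 * j)]. *)
Lemma bernoulli_power j : 1 + j%:R / 7 <= ((7 / 8) ^+ 2 * (3 / 2)) ^+ j :> R.
Proof.
elim: j => [|j IH]; first by rewrite expr0 mul0r addr0.
rewrite exprS -natr1; have j0 : 0 <= j%:R :> R by [].
apply: (@le_trans _ _ (((7 / 8) ^+ 2 * (3 / 2)) * (1 + j%:R / 7))); first by lra.
by rewrite ler_wpM2l//; lra.
Qed.

Lemma tail_stage j :
  2 * expR (- (stage_radius j ^+ 2 * (stage_pulls j)%:R / 8)) <=
  2 * (eps * delta) ^+ 21 * 4^-1 ^+ j.
Proof.
have e0 := eps0; have e1 := eps1; have d0 := delta0; have d1 := delta1.
rewrite -[X in _ <= X]mulrA ler_wpM2l//.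
apply: (@le_trans _ _ ((eps * delta) ^+ (21 + 3 * j))); last first.
  have ed0 : 0 <= eps * delta by rewrite mulr_ge0// ltW.
  rewrite exprD ler_wpM2l ?exprn_ge0// exprM.
  have ed : eps * delta <= 4^-1.
    have : eps * delta <= 1 / 2 * (1 / 2) by apply: ler_pM => //; exact: ltW.
    by move=> h; apply: le_trans h _; lra.
  rewrite lerXn2r ?nnegrE ?exprn_ge0 ?invr_ge0//; apply: le_trans (ed).
  have ed1 : eps * delta <= 1 by apply: le_trans ed _; lra.
  by rewrite exprS ler_piMr// exprn_ile1.
rewrite -expR_log ler_expR lerN2 natrD natrM.
have L1 := log_factor_ge1.
have := ltW (truncnS_gt (stage_const * log_factor * eps ^- 2 * (3 / 2) ^+ j)).
have g2 : 0 <= stage_radius j ^+ 2 by exact: sqr_ge0.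
move=> /(ler_wpM2l g2) h.
have E : stage_radius j ^+ 2 * (stage_const * log_factor * eps ^- 2 * (3 / 2) ^+ j) / 8 =
    21 * log_factor * ((7 / 8) ^+ 2 * (3 / 2)) ^+ j.
  rewrite /stage_radius /stage_const !(exprMn _ ((7 / 8) ^+ 2)) exprMn [((7 / 8) ^+ j) ^+ 2]exprAC.
  move: ((7 / 8) ^+ 2 ^+ j) ((3 / 2) ^+ j) => a b.
  by field; rewrite lt0r_neq0.
apply: (@le_trans _ _ (21 * log_factor * ((7 / 8) ^+ 2 * (3 / 2)) ^+ j)); last first.
  by rewrite -E ler_wpM2r.
apply: (@le_trans _ _ (21 * log_factor * (1 + j%:R / 7))); first by lra.
by rewrite ler_wpM2l ?bernoulli_power//; lra.
Qed.

Lemma stage_radius_ge0 j : 0 <= stage_radius j.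
Proof.
apply: mulr_ge0; first by apply: divr_ge0; [exact: ltW|exact: ler0n].
by apply: exprn_ge0; apply: divr_ge0; exact: ler0n.
Qed.

Lemma stage_radius_le j : stage_radius j <= eps / 64.
Proof.
have e0 := eps0; have e1 := eps1.
rewrite /stage_radius; apply: (@le_trans _ _ (eps / 256)).
  apply: ler_piMr; first by apply: divr_ge0; [exact: ltW|exact: ler0n].
  by apply: exprn_ile1; lra.
lra.
Qed.

Lemma stage_radius_sum J : 2 * \sum_(j < J) stage_radius j <= eps / 16.
Proof.
have e0 := eps0; have e1 := eps1.
suff : \sum_(j < J) stage_radius j = eps / 32 * (1 - (7 / 8) ^+ J).
  have : 0 <= (7 / 8 : R) ^+ J by apply: exprn_ge0; lra.
  move=> /(mulr_ge0 (ltW eps0)) h ->; lra.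
elim: J => [|J IH]; first by rewrite big_ord0 expr0 subrr mulr0.
by rewrite big_ord_recr /= IH /stage_radius exprS; field.
Qed.

End Tuning.

(** * Both procedures under the chosen parameters *)

Section Runs.
Variables (R : realType) (n K : nat) (eps delta : R).
Variables (theta dl : 'I_n -> R) (Top : {set 'I_n}) (thK Ps : R) (t : nat).
Hypothesis rk : ranked K eps theta dl Top thK Ps t.
Hypotheses (K0 : (0 < K)%N) (Kn : (K.*2 <= n)%N).
Hypotheses (eps0 : 0 < eps) (eps1 : eps <= 1 / 2).
Hypotheses (delta0 : 0 < delta) (delta1 : delta <= 1 / 2).
Variable X : 'I_n -> nat -> R.
Hypothesis X01 : forall i k, 0 <= X i k <= 1.

Let L := log_factor eps delta.
Let c1 := base_const R.
Let c2 := stage_const R.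
Let Nb := base_pulls eps delta.
Let Ns := stage_pulls eps delta.
Let last := last_phase eps.
Let alpha := stage_radius eps.
Let mis i := min_inv_sq (dl i) (Num.max eps Ps).

(** [262 = 128 + 6 + 128]: estimates paid for by gaps, exceptional arms, and base estimates charged
    to the at most [4 / eps] phases at [32 * eps * n] each. Likewise [32 = 4 * 8] for the
    tournaments. *)
Definition pulls_const : R := 262 * base_const R + 32 * stage_const R.

Lemma mis_ge (a : R) i : dl i <= a -> Num.max eps Ps <= a -> a ^- 2 <= mis i.
Proof.
move=> da ma; have /andP[d0 _] := rk_gap rk i; apply: min_inv_sq_ge; first by rewrite d0.
by rewrite ma andbT lt_max eps0.
Qed.

Lemma mis_ge1 i : 1 <= mis i.
Proof.
have /andP[_ d1] := rk_gap rk i; have := @mis_ge 1 i d1.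
rewrite expr1n invr1; apply; rewrite ge_max (rk_Psi rk) andbT.
by apply: le_trans eps1 _; lra.
Qed.

Lemma sum_mis : n%:R <= \sum_i mis i.
Proof.
rewrite -[X in X%:R <= _]card_ord -sum1_card natr_sum.
by apply: ler_sum => i _; exact: mis_ge1.
Qed.

Let c1L : 0 <= c1 * L.
Proof.
by rewrite mulr_ge0 ?ltW ?base_const_gt0// (lt_le_trans _ (log_factor_ge1 _ _ _ _)).
Qed.

Let c2L : 0 <= c2 * L.
Proof.
by rewrite mulr_ge0 ?ltW ?stage_const_gt0// (lt_le_trans _ (log_factor_ge1 _ _ _ _)).
Qed.

Let mis_ge0 i : 0 <= 128 * (c1 * L) * mis i.
Proof.
apply: mulr_ge0; first by apply: mulr_ge0.
by apply: le_trans (mis_ge1 i).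
Qed.

(** [128 = 2 * 4 * 16]: rounding, the passage from phase [r] to [r.+1], and the square of the 4 in
    the bound [4 * gam R r] on the gaps. Arms of [E] may be pulled up to the final accuracy. *)
Definition pull_budget (E : {set 'I_n}) (i : 'I_n) : R :=
  128 * (c1 * L) * mis i + (if i \in E then 32 * (c1 * L * eps ^- 2) else 0).

Let exc0 : 0 <= 32 * (c1 * L * eps ^- 2).
Proof. by rewrite mulr_ge0// mulr_ge0// invr_ge0 exprn_ge0// ltW. Qed.

Lemma pull_budget_ge0 E i : 0 <= pull_budget E i.
Proof.
by apply: addr_ge0 => //; case: ifP.
Qed.

Lemma pull_budget_init E i : (Nb 0)%:R <= pull_budget E i.
Proof.
have h := base_pulls_le eps0 eps1 delta0 delta1 0.
apply: (le_trans h); rewrite expr0 mulr1 /pull_budget -/L -/c1.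
have : 0 <= (if i \in E then 32 * (c1 * L * eps ^- 2) else 0) by case: ifP.
have := ler_wpM2l c1L (mis_ge1 i); have cl := c1L; rewrite mulr1; lra.
Qed.

Lemma pull_budget_exc (E : {set 'I_n}) i r : i \in E -> (r <= last)%N -> (Nb r)%:R <= pull_budget E i.
Proof.
move=> iE rl; apply: (le_trans (base_pulls_last eps0 eps1 delta0 delta1 rl)).
by rewrite /pull_budget iE lerDr.
Qed.

Lemma pull_budget_step (E : {set 'I_n}) i r : dl i <= 4 * gam R r -> Num.max eps Ps <= 4 * gam R r ->
  (Nb r.+1)%:R <= pull_budget E i.
Proof.
move=> dg mg; have h := mis_ge dg mg.
apply: (le_trans (base_pulls_le eps0 eps1 delta0 delta1 r.+1)); rewrite exprS /pull_budget.
have e : 4 ^+ r <= 16 * mis i.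
  have g0 := gam_gt0 R r; have gs := gam_sqr R r.
  have -> : 4 ^+ r = 16 * (4 * gam R r) ^- 2.
    have gn : gam R r ^+ 2 != 0 by rewrite lt0r_neq0// exprn_gt0.
    have -> : 4 ^+ r = (gam R r ^+ 2)^-1 by apply: (mulfI gn); rewrite gs mulfV.
    by field; rewrite lt0r_neq0.
  by rewrite ler_wpM2l.
have : 0 <= (if i \in E then 32 * (c1 * L * eps ^- 2) else 0) by case: ifP.
have := ler_wpM2l c1L e; rewrite -/c1 -/L; lra.
Qed.

Lemma sum_pull_budget (E : {set 'I_n}) : \sum_i pull_budget E i =
  128 * (c1 * L) * (\sum_i mis i) + #|E|%:R * (32 * (c1 * L * eps ^- 2)).
Proof.
rewrite big_split /= -mulr_sumr; congr (_ + _).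
by rewrite -big_mkcond /= sumr_const -[LHS]mulr_natl.
Qed.

Lemma small_run (B : {set 'I_n}) :
  (forall i r, i \notin B -> (r <= last)%N -> `|emp (X i) (Nb r) - theta i| <= gam R r / 16) ->
  400 * #|B|%:R <= eps ^+ 2 * K%:R ->
  let p := small_phase K eps Nb last 0 finset.set0 [set: 'I_n] in
  [/\ #|run p X| = K,
      \sum_(i in Top) theta i - \sum_(i in run p X) theta i <= K%:R * eps &
      (\sum_i demand p X i)%N%:R <= pulls_const * L * \sum_i mis i].
Proof.
move=> good cB.
have e0 := eps0; have e1 := eps1.
have B0 : 0 <= #|B|%:R :> R by [].
have bs : 100 * ((last.+1 * #|B|)%:R) <= K%:R * eps.
  rewrite natrM; have := last_phase_le eps0 eps1; rewrite -/last => h.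
  have := ler_wpM2r B0 h; have : 4 / eps * #|B|%:R <= K%:R * eps / 100.
    rewrite mulrAC ler_pdivrMr//; lra.
  lra.
have [] := @small_phase_correct _ n K eps Nb theta dl Top thK Ps t rk eps0 X last B #|B|
  (pull_budget B) X01 (gam_last eps0 eps1) (leqnn _) bs good
  (fun i r iB rl => pull_budget_exc iB rl)
  (fun i r _ _ dg mg => pull_budget_step B dg mg)
  (pull_budget_ge0 B) last 0 finset.set0 [set: 'I_n] (add0n _).
  split.
  - by rewrite -setI_eq0 finset.set0I.
  - by rewrite cards0 subn0 cardsT card_ord K0; split => //; move: Kn K0; clear; lia.
  - by rewrite finset.set0D cards0.
  - by rewrite finset.set0U finset.setDT cards0.
  - by move=> i _; exact: pull_budget_init.
move=> cT regT rqT; split => //.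
rewrite natr_sum; apply: (le_trans (ler_sum _ (fun i _ => rqT i))).
rewrite sum_pull_budget /pulls_const -/c1 -/c2.
have sm := sum_mis.
have KnR : K%:R <= n%:R :> R by rewrite ler_nat; move: Kn; clear; lia.
have H0 : 0 <= \sum_i mis i by apply: le_trans sm.
have : #|B|%:R * (32 * (c1 * L * eps ^- 2)) <= c1 * L * \sum_i mis i.
  have -> : #|B|%:R * (32 * (c1 * L * eps ^- 2)) = c1 * L * (32 * #|B|%:R / eps ^+ 2) by ring.
  rewrite ler_wpM2l// ler_pdivrMr ?exprn_gt0//.
  have e2 : 0 <= eps ^+ 2 by exact: sqr_ge0.
  apply: (@le_trans _ _ (K%:R * eps ^+ 2)); first by lra.
  by rewrite ler_wpM2r// (le_trans KnR).
have := mulr_ge0 c1L H0; have := mulr_ge0 c2L H0; lra.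
Qed.

Definition stages : nat := trunc_log 2 (Num.truncn (eps ^+ 3 * n%:R / K%:R)).
Definition slack : nat := Num.truncn (K%:R * eps / 100).

Hypothesis large : 4 * K%:R <= eps ^+ 3 * n%:R.

Let K0R : 0 < K%:R :> R. Proof. by rewrite ltr0n. Qed.

Let x4 : 4 <= eps ^+ 3 * n%:R / K%:R.
Proof. by rewrite ler_pdivlMr. Qed.

Lemma stages_gt1 : (1 < stages)%N.
Proof.
have h := x4; rewrite /stages.
have h4 : (2 ^ 2 <= Num.truncn (eps ^+ 3 * n%:R / K%:R))%N.
  by rewrite truncn_ge_nat; [exact: h|lra].
exact: trunc_log_max.
Qed.

Lemma stage_size0_le : (stage_size K stages 0)%:R <= eps ^+ 3 * n%:R.
Proof.
have h := x4; rewrite /stage_size subn0 natrM mulrC -ler_pdivlMr//.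
apply: (@le_trans _ _ (Num.truncn (eps ^+ 3 * n%:R / K%:R))%:R).
  by rewrite ler_nat; apply: trunc_logP => //; rewrite truncn_gt0; lra.
by rewrite truncn_le; lra.
Qed.

Lemma stage_size0_ge : eps ^+ 3 * n%:R <= 2 * (stage_size K stages 0)%:R.
Proof.
rewrite /stage_size subn0 natrM mulrCA -natrM -expnS -ler_pdivrMl// [X in X <= _]mulrC.
apply: le_trans (ltW (truncnS_gt _)) _; rewrite ler_nat.
exact: trunc_log_ltn.
Qed.

Lemma stage_sizeE j : (j <= stages)%N ->
  (stage_size K stages j)%:R = (stage_size K stages 0)%:R / 2 ^+ j :> R.
Proof.
move=> jJ; rewrite /stage_size subn0 -[X in _ = (K * 2 ^ X)%N%:R / _](subnK jJ).
by rewrite expnD !natrM !natrX mulrA mulfK// lt0r_neq0// exprn_gt0.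
Qed.

Lemma geometric_sum J : \sum_(j < J) (3 / 4) ^+ j <= 4 :> R.
Proof.
suff -> : \sum_(j < J) (3 / 4) ^+ j = 4 * (1 - (3 / 4) ^+ J) :> R.
  have : 0 <= (3 / 4 : R) ^+ J by apply: exprn_ge0; lra.
  lra.
elim: J => [|J IH]; first by rewrite big_ord0 expr0 subrr mulr0.
by rewrite big_ord_recr /= IH exprS; field.
Qed.

Lemma phase_charge r : (r <= last)%N ->
  (stage_size K stages 0)%:R * (Nb r)%:R +
  \sum_(j < stages.+1) (stage_size K stages j)%:R * (Ns j)%:R
    <= (32 * (c1 * L) + 8 * (c2 * L)) * (eps * n%:R).
Proof.
move=> rl; have e2 : 0 < eps ^+ 2 by exact: exprn_gt0.
have m0 : (stage_size K stages 0)%:R * eps ^- 2 <= eps * n%:R.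
  by rewrite ler_pdivrMr// mulrAC -exprS; exact: stage_size0_le.
rewrite mulrDl lerD//.
  have := base_pulls_last eps0 eps1 delta0 delta1 rl; rewrite -/c1 -/L -/Nb => h.
  apply: (@le_trans _ _ ((stage_size K stages 0)%:R * (32 * (c1 * L * eps ^- 2)))).
    by rewrite ler_wpM2l.
  rewrite (_ : _ * _ = 32 * (c1 * L) * ((stage_size K stages 0)%:R * eps ^- 2)); last by ring.
  by rewrite ler_wpM2l// mulr_ge0.
apply: (@le_trans _ _ (\sum_(j < stages.+1)
    2 * (c2 * L) * ((stage_size K stages 0)%:R * eps ^- 2) * (3 / 4) ^+ j)).
  apply: ler_sum => j _; rewrite stage_sizeE -1?ltnS//.
  have := stage_pulls_le eps0 eps1 delta0 delta1 j; rewrite -/c2 -/L -/Ns => h.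
  apply: (@le_trans _ _ ((stage_size K stages 0)%:R / 2 ^+ j *
     (2 * (c2 * L * eps ^- 2 * (3 / 2) ^+ j)))).
    by rewrite ler_wpM2l// divr_ge0// exprn_ge0.
  rewrite (_ : 3 / 4 = 3 / 2 / 2 :> R); last by field.
  rewrite [(3 / 2 / 2) ^+ j]exprMn exprVn le_eqVlt; apply/orP; left; apply/eqP; ring.
rewrite -mulr_sumr; have cl := c2L.
have m0' : 0 <= 2 * (c2 * L) * ((stage_size K stages 0)%:R * eps ^- 2).
  by apply: mulr_ge0; [exact: mulr_ge0|apply: mulr_ge0; rewrite // invr_ge0 ltW].
apply: (le_trans (ler_wpM2l m0' (geometric_sum _))).
have := ler_wpM2l cl m0; lra.
Qed.

Lemma large_run (Bb : {set 'I_n}) (Bs : nat -> {set 'I_n}) (G : {set 'I_n}) :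
  (forall i r, i \notin Bb -> (r <= last)%N -> `|emp (X i) (Nb r) - theta i| <= gam R r / 16) ->
  (forall i j, i \notin Bs j -> (j <= stages)%N -> `|emp (X i) (Ns j) - theta i| <= alpha j) ->
  Bb \subset G -> (forall j, (j <= stages)%N -> Bs j \subset G) ->
  16 * #|Bb|%:R <= eps ^+ 3 * n%:R ->
  (forall j, (j <= stages)%N -> 400 * #|Bs j|%:R <= eps * (stage_size K stages j)%:R) ->
  400 * #|Top :&: G|%:R <= eps * K%:R ->
  let p := large_phase K Nb Ns stages slack last 0 0 [set: 'I_n] in
  [/\ #|run p X| = K,
      \sum_(i in Top) theta i - \sum_(i in run p X) theta i <= K%:R * eps &
      (\sum_i demand p X i)%N%:R <= pulls_const * L * \sum_i mis i].
Proof.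
move=> gb gs BbG BsG cBb cBs cG.
have e0 := eps0; have e1 := eps1; have lg := large; have k0 := K0R.
have Keps0 : 0 <= K%:R * eps by rewrite mulr_ge0// ltW.
have sl1 : slack%:R <= K%:R * eps / 100 by rewrite truncn_le; lra.
have halfP (m : nat) : 200 * m%:R <= K%:R * eps -> (m <= slack./2)%N.
  move=> Hm; rewrite -[m]doubleK; apply: half_leq; rewrite truncn_ge_nat; last by lra.
  by rewrite -muln2 natrM; lra.
have sJ : stage_size K stages stages = K by rewrite /stage_size subnn muln1.
have sK : (slack < K)%N.
  by rewrite -(ltr_nat R); apply: le_lt_trans sl1 _; have := ler_wpM2l (ltW k0) e1; lra.
have card_stage j : (j <= stages)%N -> (16 * #|Bs j| <= stage_size K stages j)%N.
  move=> jJ; rewrite -(ler_nat R) natrM; have := cBs j jJ.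
  have : eps * (stage_size K stages j)%:R <= 1 * (stage_size K stages j)%:R.
    by rewrite ler_wpM2r//; lra.
  have : 0 <= #|Bs j|%:R :> R by [].
  lra.
(* From the last but one stage on, the field has at most [2 * K] arms; hence 400 in the hypothesis
   where [halfP] asks for 200. *)
have card_last j : (j <= stages)%N -> (stages <= j.+1)%N -> (#|Bs j| <= slack./2)%N.
  move=> jJ Jj; apply: halfP; have := cBs j jJ.
  have : (stage_size K stages j)%:R <= 2 * K%:R :> R.
    rewrite -natrM ler_nat /stage_size mulnC leq_mul2r.
    by apply/orP; right; rewrite -[X in (_ <= X)%N]expn1 leq_exp2l// leq_subLR addn1.
  move=> /(ler_wpM2l (ltW e0)); lra.
have card_base : (8 * #|Bb| <= stage_size K stages 0)%N.
  by rewrite -(ler_nat R) natrM; have := stage_size0_ge; lra.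
have q0 : 0 <= (32 * (c1 * L) + 8 * (c2 * L)) * (eps * n%:R).
  by apply: mulr_ge0; [apply: addr_ge0; exact: mulr_ge0|apply: mulr_ge0 => //; exact: ltW].
have cTopG : (#|Top :&: G| <= slack./2)%N by apply: halfP; lra.
have beta_s : (2 * slack./2 <= slack)%N.
  by rewrite -[X in (_ <= X)%N]odd_double_half -mul2n leq_addl.
have s_eps : 100 * slack%:R <= K%:R * eps by lra.
have Bd_bad i r : i \in Bb -> (r <= last)%N -> (Nb r)%:R <= pull_budget (Bb :|: Top) i.
  by move=> iB; apply: pull_budget_exc; rewrite finset.in_setU iB.
have Bd_top i r : i \in Top -> (r <= last)%N -> (Nb r)%:R <= pull_budget (Bb :|: Top) i.
  by move=> iT; apply: pull_budget_exc; rewrite finset.in_setU iT orbT.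
have inv0 : large_inv K eps Nb stages slack theta Top G slack./2
    (pull_budget (Bb :|: Top)) 0 0 [set: 'I_n].
  split => //.
  - by rewrite cardsT card_ord; move: Kn; clear; lia.
  - have -> : [set i | (0 - eps / 64 <= theta i)%R] = [set: 'I_n].
      by apply/setP => i; rewrite !inE; have := rk_theta rk i; lra.
    by rewrite cardsT card_ord; move: Kn; clear; lia.
  - exists finset.set0; split; first by rewrite cards0.
    by move=> i _ _; exact: pull_budget_init.
have [cT regT [Q [Q0 Qs Qr]]] := large_phase_correct rk eps0
  (gam_last eps0 eps1) (last_gam eps0 eps1) stages_gt1 gb gs
  (stage_radius_ge0 eps0) (stage_radius_sum eps0 eps1 stages) (stage_radius_le eps0 eps1 stages)
  BbG BsG card_base card_stage card_last cTopG beta_s sK s_eps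
  (pull_budget_ge0 _) Bd_bad Bd_top (fun i r _ dg mg => pull_budget_step _ dg mg) phase_charge
  q0 (add0n last) inv0.
split => //.
rewrite natr_sum; apply: (le_trans (ler_sum _ (fun i _ => Qr i))).
rewrite big_split /= sum_pull_budget.
have sm := sum_mis; have H0 : 0 <= \sum_i mis i by apply: le_trans sm.
have cl1 := c1L; have cl2 := c2L.
have n0 : 0 <= n%:R :> R by [].
have bK : #|Bb :|: Top|%:R * (32 * (c1 * L * eps ^- 2)) <= 6 * (c1 * L * n%:R).
  have cU : #|Bb :|: Top|%:R <= #|Bb|%:R + K%:R :> R.
    by rewrite -natrD ler_nat -(rk_card rk); exact: (leq_card_setU Bb Top).1.
  have e2 : 0 < eps ^+ 2 by exact: exprn_gt0.
  rewrite (_ : _ * _ = c1 * L * (32 * #|Bb :|: Top|%:R / eps ^+ 2)); last by ring.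
  rewrite (_ : 6 * _ = c1 * L * (6 * n%:R)); last by ring.
  rewrite ler_wpM2l// ler_pdivrMr//.
  have : eps ^+ 3 * n%:R <= n%:R * eps ^+ 2 / 2.
    rewrite exprS mulrC -mulrA mulrCA [eps * _]mulrC.
    have := ler_wpM2l (mulr_ge0 n0 (ltW e2)) e1; lra.
  lra.
have qq : last.+1%:R * ((32 * (c1 * L) + 8 * (c2 * L)) * (eps * n%:R)) <=
    (128 * (c1 * L) + 32 * (c2 * L)) * n%:R.
  apply: (le_trans (ler_wpM2r q0 (last_phase_le eps0 eps1))).
  rewrite le_eqVlt; apply/orP; left; apply/eqP; field; exact: lt0r_neq0.
have h1 := ler_wpM2l cl1 sm; have h2 := ler_wpM2l cl2 sm.
rewrite /pulls_const -/c1 -/c2; lra.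
Qed.

End Runs.

(** * Probability of the good event *)

Section WeightedCount.
Variables (R : realType) (I J : finType).

Lemma weighted_count (B : {set I}) (w : R) (f : I -> J -> R) :
  (forall i j, 0 <= f i j) -> (forall i, i \in B -> exists j, w <= f i j) ->
  w * #|B|%:R <= \sum_(p : I * J) f p.1 p.2.
Proof.
move=> f0 H; rewrite -(pair_bigA _ f) /= mulr_natr -sumr_const big_mkcond /=.
apply: ler_sum => i _; case: ifPn => [/H[j wj]|_]; last exact: sumr_ge0.
by rewrite (bigD1 j) //= (le_trans wj)// lerDl sumr_ge0.
Qed.

End WeightedCount.

(** * Arithmetic of the failure probability *)

Section FailureBudget.
Variables (R : realType) (n K eps delta u lp : R).
Hypotheses (n0 : 0 < n) (K0 : 0 < K) (eps0 : 0 < eps) (eps1 : eps <= 1 / 2) (u0 : 0 <= u).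
Hypothesis lp_le : lp <= 4 / eps.

(** The power 6 collects 3 from [n <= 4 * K / eps ^+ 3], 2 from the weight and 1 from the number of
    phases; the constant is [4 * 4 * 400 * 2 <= 2 ^+ 15]. *)
Lemma small_budget : 2 ^+ 15 * u <= eps ^+ 6 * delta -> eps ^+ 3 * n <= 4 * K ->
  n * lp * (400 / (eps ^+ 2 * K) * (2 * u)) <= delta.
Proof.
move=> hu small; have e6 : 0 < eps ^+ 6 by exact: exprn_gt0.
have y0 : 0 <= u / eps ^+ 6 by apply: divr_ge0 => //; exact: ltW.
have c0 : 0 <= n * (400 / (eps ^+ 2 * K) * (2 * u)).
  apply: mulr_ge0; first exact: ltW.
  apply: mulr_ge0; last by apply: mulr_ge0; [exact: ler0n|exact: u0].
  apply: divr_ge0; first exact: ler0n.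
  by apply: mulr_ge0; [apply: exprn_ge0; exact: ltW|exact: ltW].
have := ler_wpM2r c0 lp_le.
have -> : 4 / eps * (n * (400 / (eps ^+ 2 * K) * (2 * u))) =
    25 * (128 * (u / eps ^+ 6)) * ((eps ^+ 3 * n) / K).
  by field; rewrite !lt0r_neq0.
have h : (eps ^+ 3 * n) / K <= 4 by rewrite ler_pdivrMr.
have c1 : 0 <= 25 * (128 * (u / eps ^+ 6)).
  by apply: mulr_ge0; [exact: ler0n|apply: mulr_ge0; [exact: ler0n|exact: y0]].
have := ler_wpM2l c1 h.
have : 2 ^+ 15 * (u / eps ^+ 6) <= delta by rewrite mulrA ler_pdivrMr// [delta * _]mulrC.
have -> : n * lp * (400 / (eps ^+ 2 * K) * (2 * u)) =
    lp * (n * (400 / (eps ^+ 2 * K) * (2 * u))) by ring.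
move: y0; move: (u / eps ^+ 6) (eps ^+ 3 * n / K) (lp * _) => y z q; lra.
Qed.

Lemma base_budget : n * (16 / (eps ^+ 3 * n) * (2 * u) * lp) <= 128 * (u / eps ^+ 4).
Proof.
have c0 : 0 <= n * (16 / (eps ^+ 3 * n) * (2 * u)).
  apply: mulr_ge0; first exact: ltW.
  apply: mulr_ge0; last by apply: mulr_ge0; [exact: ler0n|exact: u0].
  apply: divr_ge0; first exact: ler0n.
  by apply: mulr_ge0; [apply: exprn_ge0; exact: ltW|exact: ltW].
rewrite [X in X <= _]mulrA; apply: (le_trans (ler_wpM2l c0 lp_le)).
by rewrite le_eqVlt; apply/orP; left; apply/eqP; field; rewrite !lt0r_neq0.
Qed.

Lemma stage_budget (m0 x : R) : 0 < m0 -> x <= 2 -> eps ^+ 3 * n <= 2 * m0 ->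
  n * (800 * u / (eps * m0) * x) <= 25 * (128 * (u / eps ^+ 4)).
Proof.
move=> m00 x2 hm.
have c0 : 0 <= n * (800 * u / (eps * m0)).
  apply: mulr_ge0; first exact: ltW.
  apply: divr_ge0; first by apply: mulr_ge0; [exact: ler0n|exact: u0].
  by apply: mulr_ge0; exact: ltW.
rewrite mulrA; apply: (le_trans (ler_wpM2l c0 x2)).
have -> : n * (800 * u / (eps * m0)) * 2 = 25 * (64 * (u / eps ^+ 4)) * ((eps ^+ 3 * n) / m0).
  by field; rewrite !lt0r_neq0.
have h : (eps ^+ 3 * n) / m0 <= 2 by rewrite ler_pdivrMr.
have c1 : 0 <= 25 * (64 * (u / eps ^+ 4)).
  apply: mulr_ge0; first exact: ler0n; apply: mulr_ge0; first exact: ler0n.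
  by apply: divr_ge0 => //; apply: exprn_ge0; exact: ltW.
by have := ler_wpM2l c1 h; set a := _ * (_ / m0); lra.
Qed.

Lemma top_budget (x : R) : x <= 2 ->
  K * (400 / (eps * K) * (2 * u * lp + 2 * u * x)) <= 38 * (128 * (u / eps ^+ 4)).
Proof.
move=> x2; have u20 : 0 <= 2 * u by apply: mulr_ge0; [exact: ler0n|exact: u0].
have e4 : 0 < eps ^+ 4 by exact: exprn_gt0.
have -> : K * (400 / (eps * K) * (2 * u * lp + 2 * u * x)) =
    400 / eps * (2 * u * (lp + x)) by field; rewrite !lt0r_neq0.
have h1 : lp + x <= 6 / eps.
  have : 2 <= 2 / eps by rewrite ler_pdivlMr//; have := eps1; lra.
  have := lp_le; lra.
have c0 : 0 <= 400 / eps by apply: divr_ge0; [exact: ler0n|exact: ltW].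
apply: (le_trans (ler_wpM2l c0 (ler_wpM2l u20 h1))).
have -> : 400 / eps * (2 * u * (6 / eps)) = 2 * (20 * (120 * (u / eps ^+ 2))).
  by field; rewrite lt0r_neq0.
have h2 : u / eps ^+ 2 <= u / eps ^+ 4.
  apply: ler_wpM2l => //; rewrite lef_pV2 ?posrE ?exprn_gt0//.
  rewrite (exprD eps 2 2) ler_piMr ?exprn_ge0 ?(ltW eps0)// exprn_ile1 ?(ltW eps0)//.
  by have := eps1; lra.
have : 0 <= u / eps ^+ 4 by apply: divr_ge0 => //; exact: ltW.
move: (u / eps ^+ 2) (u / eps ^+ 4) h2 => a b; lra.
Qed.

Lemma total_budget : 2 ^+ 17 * u <= eps ^+ 4 * delta ->
  128 * (u / eps ^+ 4) + 25 * (128 * (u / eps ^+ 4)) + 38 * (128 * (u / eps ^+ 4)) <= delta.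
Proof.
move=> hu; have e4 : 0 < eps ^+ 4 by exact: exprn_gt0.
have : 2 ^+ 17 * (u / eps ^+ 4) <= delta by rewrite mulrA ler_pdivrMr// [delta * _]mulrC.
have : 0 <= u / eps ^+ 4 by apply: divr_ge0 => //; exact: ltW.
move: (u / eps ^+ 4) => y; lra.
Qed.

End FailureBudget.

(** * Good events for random rewards *)

Section Instance.
Context (R : realType) (n : nat) d (Omega : measurableType d) (P : probability Omega R).
Variables (U : Omega -> R) (X : 'I_n -> nat -> Omega -> R).
Hypothesis mX : forall i k, measurable_fun setT (X i k).
Hypothesis X01 : forall i k w, 0 <= X i k w <= 1.
Hypothesis Xid : forall i k B, measurable B ->
  P ((X i k @^-1` B)%classic) = P ((X i 0%N @^-1` B)%classic).
Hypothesis Xindep : mutually_independent P (joint_family U X).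

Let theta (i : 'I_n) : R := fine ('E_P[X i 0%N]).

Lemma arm_independent i (J : seq nat) (B : nat -> set R) : uniq J ->
    (forall j, j \in J -> measurable (B j)) ->
    P (\bigcap_(j in [set` J]) (X i j @^-1` B j))%classic =
    (\prod_(j <- J) P (X i j @^-1` B j)%classic)%E.
Proof.
move=> uJ mB.
pose B' (o : option ('I_n * nat)) := if o is Some (_, k) then B k else setT.
have inj : injective (fun j : nat => Some (i, j)) by move=> a b [].
have := Xindep (J := [seq Some (i, j) | j <- J]) (B := B').
rewrite map_inj_uniq// big_map => /(_ uJ) H; rewrite -H; last first.
  by move=> o /mapP[j jJ ->]; exact: mB.
congr (P _); apply/seteqP; split => w Hw.
- by move=> o /= /mapP[j jJ ->]; exact: Hw.
- move=> j /= jJ; apply: (Hw (Some (i, j))) => /=; exact: map_f.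
Qed.

Definition deviation (i : 'I_n) (N : nat) (a : R) : set Omega :=
  [set w | (a < `|emp (fun k => X i k w) N - theta i|)%R]%classic.

Lemma deviation_measurable i N a : measurable (deviation i N a).
Proof.
rewrite -[deviation _ _ _]setTI.
have -> : deviation i N a =
    ((fun w => `|emp ((X i)^~ w) N - theta i|) @^-1` `]a, +oo[)%classic.
  by apply/seteqP; split => w /=; rewrite in_itv /= andbT.
apply: measurableT_comp => //; apply: measurable_funB => //.
exact: (measurable_emp (mX i)).
Qed.

Lemma deviation_prob i N a : 0 < a <= 1 -> (0 < N)%N ->
  (P (deviation i N a) <= (2 * expR (- (a ^+ 2 * N%:R / 8)))%:E)%E.
Proof.
exact: (chernoff_emp (mX i) (X01 i) (Xid i) (@arm_independent i)).
Qed.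

Lemma theta01 i : 0 <= theta i <= 1.
Proof. exact: (mean01 P (mX i) (X01 i)). Qed.

Variables (K : nat) (eps delta : R).
Hypotheses (K0 : (0 < K)%N) (Kn : (K.*2 <= n)%N).
Hypotheses (eps0 : 0 < eps) (eps1 : eps <= 1 / 2).
Hypotheses (delta0 : 0 < delta) (delta1 : delta <= 1 / 2).

Let Nb := base_pulls eps delta.
Let Ns := stage_pulls eps delta.
Let last := last_phase eps.
Let alpha := stage_radius eps.
Let u := (eps * delta) ^+ 21.
Let J := stages n K eps.
Let m := stage_size K J.

Let Kp : 0 < K%:R :> R. Proof. by rewrite ltr0n. Qed.
Let np : 0 < n%:R :> R. Proof. by rewrite ltr0n; move: K0 Kn; clear; lia. Qed.

Lemma base_prob i r : (P (deviation i (Nb r) (gam R r / 16)) <= (2 * u)%:E)%E.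
Proof.
have g0 := gam_gt0 R r; have g1 := gam_le1 R r.
apply: le_trans (deviation_prob i _ _) _ => //; first by apply/andP; split; lra.
by rewrite lee_fin; exact: tail_base.
Qed.

Lemma stage_prob i j : (P (deviation i (Ns j) (alpha j)) <= (2 * u * 4^-1 ^+ j)%:E)%E.
Proof.
have a0 : 0 < alpha j.
  apply: mulr_gt0; first by apply: divr_gt0; [exact: eps0|exact: ltr0n].
  by apply: exprn_gt0; apply: divr_gt0; exact: ltr0n.
have a1 := stage_radius_le eps0 eps1 j; have e1 := eps1.
apply: le_trans (deviation_prob i _ _) _ => //.
  by apply/andP; split => //; apply: le_trans a1 _; lra.
by rewrite lee_fin; exact: tail_stage.
Qed.

(** As [eps <= 1 / 2], spare powers of [eps] absorb numerical constants. The exponent 21 is [15 + 6]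
    for the small case and [17 + 4] for the large one. *)
Lemma u_small (a b : nat) : (b + a = 21)%N -> 2 ^+ b * u <= eps ^+ a * delta.
Proof.
move=> ba; rewrite -ler_pdivlMl ?exprn_gt0// mulrCA -exprVn.
rewrite /u exprMn -{1}ba exprD mulrAC [X in _ <= X]mulrC.
have e0 := ltW eps0; have d0 := ltW delta0; have e1 := eps1; have d1 := delta1.
rewrite ler_wpM2r ?exprn_ge0//; apply: ler_pM; rewrite ?exprn_ge0//.
  by rewrite lerXn2r ?nnegrE//; lra.
by rewrite exprS ler_piMr// exprn_ile1//; lra.
Qed.

Lemma sum_pow4 N : \sum_(j < N) 4^-1 ^+ j <= 2 :> R.
Proof.
suff -> : \sum_(j < N) 4^-1 ^+ j = 4 / 3 * (1 - 4^-1 ^+ N) :> R.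
  have : 0 <= (4^-1 : R) ^+ N by rewrite exprn_ge0// invr_ge0.
  lra.
elim: N => [|N IH]; first by rewrite big_ord0 expr0 subrr mulr0.
by rewrite big_ord_recr /= IH exprS; field.
Qed.

Lemma sum_pow2 N : \sum_(j < N) 2^-1 ^+ j <= 2 :> R.
Proof.
suff -> : \sum_(j < N) 2^-1 ^+ j = 2 * (1 - 2^-1 ^+ N) :> R.
  have : 0 <= (2^-1 : R) ^+ N by rewrite exprn_ge0// invr_ge0.
  lra.
elim: N => [|N IH]; first by rewrite big_ord0 expr0 subrr mulr0.
by rewrite big_ord_recr /= IH exprS; field.
Qed.

Let u0 : 0 <= u. Proof. by rewrite exprn_ge0// mulr_ge0// ltW. Qed.

Definition base_bad (w : Omega) : {set 'I_n} :=
  [set i | [exists r : 'I_last.+1,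
     (gam R r / 16 < `|emp (fun k => X i k w) (Nb r) - theta i|)%R]].

Definition stage_bad (w : Omega) (j : nat) : {set 'I_n} :=
  [set i | (alpha j < `|emp (fun k => X i k w) (Ns j) - theta i|)%R].

Lemma base_good w i r : i \notin base_bad w -> (r <= last)%N ->
  `|emp (fun k => X i k w) (Nb r) - theta i| <= gam R r / 16.
Proof.
rewrite inE negb_exists => /forallP H rl.
by have := H (Ordinal (rl : (r < last.+1)%N)); rewrite -leNgt.
Qed.

Lemma small_event : eps ^+ 3 * n%:R <= 4 * K%:R ->
  exists A : set Omega, measurable A /\ ((1 - delta)%:E <= P A)%E /\
    forall w, A w -> 400 * #|base_bad w|%:R <= eps ^+ 2 * K%:R.
Proof.
move=> small.
have e2 : 0 < eps ^+ 2 by exact: exprn_gt0.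
pose W : R := 400 / (eps ^+ 2 * K%:R).
have eK : 0 < eps ^+ 2 * K%:R by rewrite mulr_gt0.
have W0 : 0 <= W by apply: divr_ge0; [exact: ler0n|exact: ltW].
have [|A [mA [PA HA]]] := @weighted_markov _ Omega R P ('I_n * 'I_last.+1)%type
   (fun l => deviation l.1 (Nb l.2) (gam R l.2 / 16)) (fun=> W) (fun=> 2 * u) delta
   (fun l => deviation_measurable _ _ _) (fun=> W0) (fun l => base_prob l.1 l.2).
  rewrite sumr_const card_prod !card_ord -[X in X <= _]mulr_natl natrM.
  exact: (small_budget np Kp eps0 u0 (last_phase_le eps0 eps1) (@u_small 6 15 erefl) small).
exists A; split => //; split => // w Aw.
have := @weighted_count R _ _ (base_bad w) W
  (fun i (r : 'I_last.+1) => W * \1_(deviation i (Nb r) (gam R r / 16)) w).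
move=> /(_ _ _)/le_lt_trans/(_ (HA w Aw)) H.
have : W * #|base_bad w|%:R < 1.
  apply: H => [i j|i]; first by rewrite mulr_ge0// indicE.
  rewrite inE => /existsP[r Hr]; exists r.
  by rewrite indicE mem_set ?mulr1.
rewrite /W mulrAC ltr_pdivrMr// mul1r; exact: ltW.
Qed.

(** One application of Markov's inequality yields all three counts: the weight of a pair depends on
    its stage, and pairs whose arm is in [Top] get the additional weight [wt]. The separate count
    inside [Top] is needed because unreliable arms may outnumber [K] overall. *)
Lemma large_event (Top : {set 'I_n}) : #|Top| = K ->
  exists A : set Omega, measurable A /\ ((1 - delta)%:E <= P A)%E /\
    forall w, A w -> [/\ 16 * #|base_bad w|%:R <= eps ^+ 3 * n%:R,
      forall j, (j <= J)%N -> 400 * #|stage_bad w j|%:R <= eps * (m j)%:R &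
      400 * #|Top :&: (base_bad w :|: \bigcup_(j < J.+1) stage_bad w j)|%:R <= eps * K%:R].
Proof.
move=> cTop.
have e3 : 0 < eps ^+ 3 * n%:R by rewrite mulr_gt0// exprn_gt0.
have eK : 0 < eps * K%:R by rewrite mulr_gt0.
have mp j : 0 < (m j)%:R :> R by rewrite ltr0n muln_gt0 K0 expn_gt0.
have em j : 0 < eps * (m j)%:R by rewrite mulr_gt0.
pose wb : R := 16 / (eps ^+ 3 * n%:R).
pose wt : R := 400 / (eps * K%:R).
pose ws (j : nat) : R := 400 / (eps * (m j)%:R).
have wb0 : 0 <= wb by apply: divr_ge0; [exact: ler0n|exact: ltW].
have wt0 : 0 <= wt by apply: divr_ge0; [exact: ler0n|exact: ltW].
have ws0 j : 0 <= ws j by apply: divr_ge0; [exact: ler0n|exact: ltW].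
pose L := ('I_last.+1 + 'I_J.+1)%type.
pose E (i : 'I_n) (k : L) := match k with
  | inl r => deviation i (Nb r) (gam R r / 16) | inr j => deviation i (Ns j) (alpha j) end.
pose p (k : L) : R := match k with inl r => 2 * u | inr j => 2 * u * 4^-1 ^+ j end.
pose W (i : 'I_n) (k : L) : R :=
  (match k with inl r => wb | inr j => ws j end) + (if i \in Top then wt else 0).
have W0 i k : 0 <= W i k by rewrite addr_ge0//; [case: k|case: ifP].
have [|||A [mA [PA HA]]] := @weighted_markov _ Omega R P ('I_n * L)%type
   (fun l => E l.1 l.2) (fun l => W l.1 l.2) (fun l => p l.2) delta _ (fun l => W0 l.1 l.2).
- by move=> [i [r|j]]; exact: deviation_measurable.
- by move=> [i [r|j]]; [exact: base_prob|exact: stage_prob].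
- rewrite -(pair_bigA _ (fun i k => W i k * p k)) /=.
  have sp : \sum_k p k = 2 * u * last.+1%:R + 2 * u * \sum_(j < J.+1) 4^-1 ^+ j.
    by rewrite big_sumType /= sumr_const card_ord mulr_natr mulr_sumr.
  have -> : \sum_i \sum_k W i k * p k =
      n%:R * (wb * (2 * u) * last.+1%:R + \sum_(j < J.+1) ws j * (2 * u * 4^-1 ^+ j))
      + K%:R * (wt * \sum_k p k).
    under eq_bigr => i _.
      under eq_bigr => k _ do rewrite /W mulrDl.
      rewrite big_split /= -mulr_sumr big_sumType /= sumr_const card_ord -[wb * _ *+ _]mulr_natr.
      over.
    rewrite big_split /= sumr_const card_ord -[X in X + _ = _]mulr_natl; congr (_ + _).
    by rewrite -mulr_suml mulrA -big_mkcond /= sumr_const cTop -[X in X * _ = _]mulr_natl.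
  have lp := last_phase_le eps0 eps1; rewrite -/last in lp.
  have s4 := sum_pow4 J.+1; have s2 := sum_pow2 J.+1.
  have uu : 0 <= 2 * u by rewrite mulr_ge0.
  have m0 := stage_size0_ge n eps K0; rewrite -/J -/(m 0) in m0.
  (* The weights double from stage to stage as the fields halve, while the probabilities drop by a
     factor 4, so a series of ratio [1 / 2] remains. *)
  have t2 : n%:R * (\sum_(j < J.+1) ws j * (2 * u * 4^-1 ^+ j)) <= 25 * (128 * (u / eps ^+ 4)).
    apply: le_trans (stage_budget np eps0 u0 (mp 0%N) s2 m0).
    rewrite le_eqVlt; apply/orP; left; apply/eqP; congr (_ * _); rewrite mulr_sumr.
    apply: eq_bigr => j _; rewrite /ws /m stage_sizeE -1?ltnS// -/m.
    have -> : 4^-1 ^+ j = (2^-1 ^+ j) * (2^-1 ^+ j) :> R.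
      by rewrite -exprMn; congr (_ ^+ _); field.
    rewrite !exprVn; move: (2 ^+ j) (exprn_gt0 j (ltr0n R 2 : 0 < 2 :> R)) => c c0.
    have := mp 0%N; move: (m 0)%:R => b b0.
    by field; rewrite !lt0r_neq0.
  rewrite mulrDr sp; apply: le_trans (total_budget eps0 u0 (@u_small 4 17 erefl)).
  apply: lerD; first apply: lerD => //; first exact: base_budget.
  exact: top_budget.
exists A; split => //; split => // w Aw.
have count (B : {set 'I_n}) v :
    (forall i, i \in B -> exists k, v <= W i k * \1_(E i k) w) -> v * #|B|%:R < 1.
  move=> H; apply: le_lt_trans (HA w Aw).
  by apply: weighted_count H => i k; rewrite mulr_ge0// indicE.
have T0 i : 0 <= (if i \in Top then wt else 0) by case: ifP.
split.
- have : wb * #|base_bad w|%:R < 1.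
    apply: count => i; rewrite inE => /existsP[r Hr]; exists (inl r).
    by rewrite indicE mem_set// mulr1 /W lerDl.
  by rewrite /wb mulrAC ltr_pdivrMr// mul1r; exact: ltW.
- move=> j jJ; have : ws j * #|stage_bad w j|%:R < 1.
    apply: count => i; rewrite inE => Hj; exists (inr (Ordinal (jJ : (j < J.+1)%N))).
    by rewrite indicE mem_set// mulr1 /W lerDl.
  by rewrite /ws mulrAC ltr_pdivrMr// mul1r; exact: ltW.
- set B := _ :&: _; have : wt * #|B|%:R < 1.
    apply: count => i; rewrite finset.in_setI finset.in_setU => /andP[iT /orP[|]].
      rewrite inE => /existsP[r Hr]; exists (inl r).
      by rewrite indicE mem_set// mulr1 /W iT lerDr.
    case/bigcupP => j _; rewrite inE => Hj; exists (inr j).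
    by rewrite indicE mem_set// mulr1 /W iT lerDr.
  by rewrite /wt mulrAC ltr_pdivrMr// mul1r; exact: ltW.
Qed.

End Instance.

Definition top_program (R : realType) (n K : nat) (eps delta : R) : prog R n :=
  if 4 * K%:R <= eps ^+ 3 * n%:R then
    large_phase K (base_pulls eps delta) (stage_pulls eps delta) (stages n K eps)
      (slack K eps) (last_phase eps) 0 0 [set: 'I_n]
  else small_phase K eps (base_pulls eps delta) (last_phase eps) 0 finset.set0 [set: 'I_n].

Local Open Scope classical_set_scope.

Theorem theorem2 (R : realType) :
  exists C : R, 0 < C /\
  exists alg : forall (n K : nat) (eps delta : R), policy R n,
  forall (n K : nat) (eps delta : R),
    (2 <= n)%N -> (1 <= K)%N -> (K.*2 <= n)%N ->
    0 < eps -> eps <= 1 / 2 -> 0 < delta -> delta <= 1 / 2 ->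
  forall (d : measure_display) (Omega : measurableType d) (P : probability Omega R)
         (U : Omega -> R) (X : 'I_n -> nat -> Omega -> R),
    (* internal randomness: U uniform on [0,1] *)
    measurable_fun setT U ->
    (forall w, 0 <= U w <= 1) ->
    (forall a, 0 <= a <= 1 -> P (U @^-1` `]-oo, a]) = a%:E) ->
    (* rewards supported on [0,1]; the pulls of arm i are i.i.d. *)
    (forall i k, measurable_fun setT (X i k)) ->
    (forall i k w, 0 <= X i k w <= 1) ->
    (forall i k B, measurable B -> P (X i k @^-1` B) = P (X i 0%N @^-1` B)) ->
    mutually_independent P (joint_family U X) ->
  let theta : 'I_n -> R := fun i => fine ('E_P[X i 0%N]) in
  let bound : R :=
    C * (ln (1 / eps) + ln (1 / delta)) * H_complexity K theta eps in
  exists A : set Omega, measurable A /\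
    (A `<=` [set w | exists (tau : nat) (T : {set 'I_n}),
               stops_at (alg n K eps delta) (U w) (fun i k => X i k w) tau T /\
               tau%:R <= bound /\ eps_topK K theta eps T]) /\
    ((1 - delta)%:E <= P A)%E.
Proof.
exists (pulls_const R); split.
  apply: addr_gt0; apply: mulr_gt0; try exact: ltr0n.
    exact: base_const_gt0.
  exact: stage_const_gt0.
exists (fun n K eps delta => fun=> policy_of (top_program n K eps delta)).
move=> n K eps delta _ K0 Kn e0 e1 d0 d1 d Omega P U X _ _ _ mX X01 Xid Xindep theta bound.
have th01 : forall i, 0 <= theta i <= 1 by exact: theta01.
have rk := ranked_instance th01 K0 Kn e0.
set Top := top_arms K theta in rk.
suff [A [mA [PA HA]]] : exists A : set Omega, measurable A /\ ((1 - delta)%:E <= P A)%E /\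
    forall w, A w -> let p := top_program n K eps delta in let Xw := fun i k => X i k w in
    [/\ #|run p Xw| = K,
      \sum_(i in Top) theta i - \sum_(i in run p Xw) theta i <= K%:R * eps &
      (\sum_i demand p Xw i)%N%:R <= bound].
  exists A; split => //; split => // w /HA[cT regT pulls].
  have [tau [st tle]] := prog_stops (top_program n K eps delta) (U w) (fun i k => X i k w).
  exists tau, (run (top_program n K eps delta) (fun i k => X i k w)); split => //; split.
    by apply: le_trans pulls; rewrite ler_nat.
  split => //; rewrite (regret_arms theta K0 Kn e0) ler_pdivrMr ?ltr0n// mulrC.
  exact: regT.
rewrite /bound (complexity_arms theta K0 Kn e0) /top_program.
have [large|small] := leP (4 * K%:R) (eps ^+ 3 * n%:R).
  have [A [mA [PA HA]]] := large_event mX X01 Xid Xindep K0 Kn e0 e1 d0 d1 (rk_card rk).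
  exists A; split => //; split => // w /HA[cb cs cT].
  apply: (large_run rk K0 Kn e0 e1 d0 d1 large _ _ _ _ cb cs cT).
  - by move=> i r iB rl; exact: base_good iB rl.
  - by move=> i j; rewrite inE -leNgt.
  - exact: finset.subsetUl.
  - move=> j jJ; apply: fintype.subset_trans (finset.subsetUr _ _).
    exact: (finset.bigcup_sup (Ordinal (jJ : (j < (stages n K eps).+1)%N))).
have [A [mA [PA HA]]] := small_event mX X01 Xid Xindep K0 Kn e0 e1 d0 d1 (ltW small).
exists A; split => //; split => // w /HA cb.
apply: (small_run rk K0 Kn e0 e1 d0 d1 _ _ cb).
- by move=> i k; exact: X01.
- by move=> i r iB rl; exact: base_good iB rl.
Qed.
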